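(* Assume $\operatorname{char}k=0$, $N\ge2$, and let $V$ have standard basis $x_1,\dots,x_d$ ($x_i$ even for $i\le p$, odd for $i>p$, $d=p+q$). Let $\mathcal B=k[x^i_j\mid1\le i,j\le d]$ be the free supercommutative algebra with $x^i_j$ of parity $\hat i+\hat j$, and $X=(x^i_j)$ the generic supermatrix of type $p|q$, with $\operatorname{ber}(1+tX)=\sum_{n\ge0}e_nt^n$. Then in $\mathcal B_{\bar0}[[t]]$, $$\Big(\sum_{\ell\ge0}\sum_{\mathbf i\in\Lambda(p|q,N)_\ell}(-1)^{\hat{\mathbf i}}X(\mathbf i)\,t^\ell\Big)\cdot\Big(\sum_{m\equiv0,1\bmod N}(-1)^{m\bmod N}e_mt^m\Big)=1.$$
   Context: Sign action of $\mathfrak S_n$ on $V^{\otimes n}$: $c_\sigma(v_1\otimes\cdots\otimes v_n)=(-1)^{\sum_{(i,j)\in\mathrm{inv}(\sigma)}\hat v_i\hat v_j}v_{\sigma^{-1}(1)}\otimes\cdots\otimes v_{\sigma^{-1}(n)}$ with $\mathrm{inv}(\sigma)=\{(i,j):i<j,\sigma(i)>\sigma(j)\}$. The $N$-symmetric superalgebra is $\mathsf S_N(V)=\mathsf T(V)/(c_{Y_N}(V^{\otimes N}))$, $Y_N=\frac1{N!}\sum_\sigma\operatorname{sgn}(\sigma)\sigma$. $\Lambda(p|q,N)_\ell$ is the set of sequences $\mathbf i=(i_1,\dots,i_\ell)\in\{1,\dots,d\}^\ell$ having no block of $N$ consecutive entries $(j_1,\dots,j_N)$ with $j_1<\cdots<j_m\le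 p<j_{m+1}\le\cdots\le j_N$ for some $m$; the monomials $x_{\mathbf i}=x_{i_1}\cdots x_{i_\ell}$, $\mathbf i\in\Lambda(p|q,N)_\ell$, form a basis of $\mathsf S_N(V)_\ell$. In the super tensor product $\mathsf S_N(V)\otimes\mathcal B$ put $y_i=\sum_jx_j\otimes x^j_i$ and $y_{\mathbf i}=y_{i_1}\cdots y_{i_\ell}$; $X(\mathbf i)\in\mathcal B_{\bar0}$ is defined by $y_{\mathbf i}=x_{\mathbf i}\otimes X(\mathbf i)+(\text{terms in }\bigoplus_{\mathbf j\ne\mathbf i}x_{\mathbf j}\otimes\mathcal B)$, $\mathbf j\in\Lambda(p|q,N)_\ell$. $\hat{\mathbf i}=\hat i_1+\cdots+\hat i_\ell\in\mathbb Z_2$. Berezinian of $\Phi=\begin{pmatrix}A&B'\\C&D\end{pmatrix}$ (even diagonal blocks of sizes $p,q$): $\operatorname{ber}(\Phi)=\det(A)\det(D-CA^{-1}B')^{-1}$. $m\bmod N\in\{0,\dots,N-1\}$. *)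

(* Defs.v *)
From HB Require Import structures.
From mathcomp Require Import all_boot all_order all_algebra all_fingroup.
Set Implicit Arguments. Unset Strict Implicit. Unset Printing Implicit Defensive.
Import Order.TTheory GRing.Theory Num.Theory.
Local Open Scope ring_scope.

(* Conventions (0-based):  the basis vectors of V are x_0,...,x_{d-1},
   d = p+q; x_i is even iff i < p.  Words of length l are l-tuples of
   indices, represented as {ffun 'I_l -> 'I_(p+q)}.  The generic
   supermatrix is given by a family  x a b = x^a_b  (row a, column b). *)

Section SNBer.
Variables (k : fieldType) (N p q : nat) (B : algType k).
Variable x : 'I_(p + q) -> 'I_(p + q) -> B.

Local Notation word l := {ffun 'I_l -> 'I_(p + q)}.

Definition parn (n : nat) : nat := (p <= n)%N.
Definition par (i : 'I_(p + q)) : nat := parn i.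

Definition wnth l (w : word l) (n : nat) : nat :=
  oapp (fun o : 'I_l => val (w o)) 0%N (insub n).

Definition bad_block (f : nat -> nat) (st : nat) : bool :=
  [exists m : 'I_N.+1, [forall r : 'I_N,
     [&& ((r < m)%N ==> (f (st + r)%N < p)%N),
         ((m <= r)%N ==> (p <= f (st + r)%N)%N),
         ((r.+1 < m)%N ==> (f (st + r)%N < f (st + r.+1)%N)%N) &
         (((m <= r)%N && (r.+1 < N)%N) ==> (f (st + r)%N <= f (st + r.+1)%N)%N)]]].

Definition inLambda l (w : word l) : bool :=
  [forall s : 'I_l.+1, ((s + N)%N <= l)%N ==> ~~ bad_block (wnth w) s].

Definition permn (s : 'S_N) (n : nat) : nat :=
  oapp (fun o : 'I_N => val ((s^-1)%g o)) n (insub n).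

(* the word obtained by letting c_sigma act on the block of positions
   st, ..., st+N-1 :  new letter at st+t is the old letter at st+sigma^{-1}(t) *)
Definition perm_block l (st : nat) (s : 'S_N) (w : word l) : word l :=
  [ffun r : 'I_l => if (st <= r)%N then w (insubd r (st + permn s (r - st))%N)
                    else w r].

Definition inv_sign l (st : nat) (s : 'S_N) (w : word l) : nat :=
  (\sum_(a : 'I_N) \sum_(b : 'I_N | (a < b)%N && (s b < s a)%N)
      parn (wnth w (st + a)) * parn (wnth w (st + b)))%N.

(* id^{(x)st} (x) c_{Y_N} (x) id applied to the basis tensor x_w,
   as a coordinate vector on the basis of words *)
Definition gen l (w : word l) (st : nat) (u : word l) : k :=
  (N`!%:R)^-1 * \sum_(s : 'S_N)
     (-1) ^+ s * (-1) ^+ inv_sign st s w * ((perm_block st s w == u)%:R).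

(* v lies in the degree-l component of the two-sided ideal of T(V)
   generated by c_{Y_N}(V^{(x)N}) *)
Definition in_rel l (v : word l -> k) : Prop :=
  exists c : word l -> nat -> k, forall u : word l,
    v u = \sum_(w : word l) \sum_(st < l.+1 | (st + N <= l)%N) c w st * gen w st u.

(* coef l w i (i in Lambda) are the coordinates of the class of x_w in
   S_N(V)_l on the basis (x_i)_{i in Lambda(p|q,N)_l} *)
Definition is_expansion (coef : forall l, word l -> word l -> k) : Prop :=
  forall l (w : word l),
    in_rel (fun u => (u == w)%:R - \sum_(i : word l | inLambda i) coef l w i * (u == i)%:R).

(* sign produced by the super tensor product when expanding
   y_{i_1}...y_{i_l} = sum_w +- x_w (x) x^{w_1}_{i_1} ... x^{w_l}_{i_l} *)
Definition tsign l (w i : word l) : nat :=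
  (\sum_(r < l) \sum_(s < l | (r < s)%N) (par (w r) + par (i r)) * par (w s))%N.

Definition Xof (coef : forall l, word l -> word l -> k) l (i : word l) : B :=
  \sum_(w : word l)
     (-1) ^+ tsign w i * (coef l w i *: \prod_(r < l) x (w r) (i r)).

Definition Fser (coef : forall l, word l -> word l -> k) l : B :=
  \sum_(i : word l | inLambda i) (-1) ^+ (\sum_(r < l) par (i r))%N * Xof coef i.

Definition tX (a b : 'I_(p + q)) : {poly B} := (x a b)%:P * 'X.
Definition A0 : 'M[{poly B}]_p := \matrix_(a, b) tX (lshift q a) (lshift q b).
Definition B0 : 'M[{poly B}]_(p, q) := \matrix_(a, b) tX (lshift q a) (rshift p b).
Definition C0 : 'M[{poly B}]_(q, p) := \matrix_(a, b) tX (rshift p a) (lshift q b).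
Definition D0 : 'M[{poly B}]_q := \matrix_(a, b) tX (rshift p a) (rshift p b).

(* (1 + A0)^{-1} modulo t^M  (geometric series; A0 = O(t)) *)
Definition Ainv (M : nat) : 'M[{poly B}]_p :=
  \sum_(j < M) iter j (mulmx (- A0)) 1%:M.

Definition Schur (M : nat) : 'M[{poly B}]_q :=
  (1%:M + D0) - C0 *m Ainv M *m B0.

(* ber(1+tX) = det(A) det(D - C A^{-1} B')^{-1}  modulo t^M;
   det(Schur) = 1 + O(t), inverted by the geometric series *)
Definition ber_tr (M : nat) : {poly B} :=
  \det (1%:M + A0) * \sum_(j < M) (1 - \det (Schur M)) ^+ j.

Definition ecoef (m : nat) : B := (ber_tr m.+1)`_m.

Definition Gser (m : nat) : B :=
  if (m %% N == 0)%N || (m %% N == 1)%N then (-1) ^+ (m %% N) * ecoef m else 0.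

End SNBer.

(* Main.v *)
(* In V^{\otimes n} there is a basis b_w, triangular with respect to the words x_w for the
   lexicographic order, such that b_w is antisymmetric (for the sign action) at the
   ascents of w, and such that every subspace of tensors antisymmetric at a given set of
   positions is spanned by the b_w it contains. The coaction commutes with the sign action,
   hence its matrix T' in this basis is triangular for the inclusion of ascent sets. Writing
   F_l for the supertrace on S_N(V)_l and E_m for the supertrace on the antisymmetric part
   of V^{\otimes m}, the product F_l E_m is then the sum of the diagonal entries T'_{ww} over
   the words w of length l+m whose first l letters form a word of Lambda and whose last m
   letters are ascending. For fixed w these conditions select a window of consecutive values
   of m on which the signs [m = 0 mod N] - [m = 1 mod N] add up to 0, unless w is empty.
   Finally E_m = e_m, because both sequences satisfy Newton's identities
     n e_n = sum_r (-1)^r str(X^{r+1}) e_{n-1-r}: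
   for E_m by splitting the antisymmetrizer along cosets of S_{n-1} in S_n, for the
   Berezinian by computing t d/dt log ber(1+tX) = str(tX(1+tX)^{-1}) from its definition. *)

Require Import Defs.
From Stdlib Require Import Setoid Morphisms.
From HB Require Import structures.
From mathcomp Require Import all_boot all_order all_algebra all_fingroup.
From mathcomp Require Import boolp zify.
Import Order.TTheory GRing.Theory Num.Theory.
Set Implicit Arguments. Unset Strict Implicit. Unset Printing Implicit Defensive.
Local Open Scope ring_scope.

(** * Words, ascents and the adapted basis *)


(** The normal form modulo the relations is a projection whose kernel is a sum of spaces of tensors
    antisymmetric on a block, while the antisymmetrizer of the last m factors has an intersection of
    such spaces as its image. A basis adapted to all adjacent antisymmetries at once turns both into
    coordinate subspaces. The same triangularity shows that the words of Lambda are independent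
    modulo the relations, so that the coordinates on Lambda are determined although [coef] is only
    given as some expansion. On the side of the Berezinian, the algebra [B] carries no grading:
    parity is read off from commutation signs, and determinants are computed in the commutative ring
    of the elements that are even in this sense. Power series in t are handled as polynomials modulo
    t^M. *)

Section TupleSums.
Variables (T : finType) (V : nmodType).

Lemma big_tuple0 (f : seq T -> V) : \sum_(t : 0.-tuple T) f t = f [::].
Proof.
rewrite (bigD1 [tuple]) //= big1 ?addr0 // => t /negP[].
by apply/eqP/val_inj; rewrite /= (tuple0 t).
Qed.

Lemma big_tuple_cons n (f : seq T -> V) :
  \sum_(t : n.+1.-tuple T) f t = \sum_a \sum_(t : n.-tuple T) f (a :: t).
Proof.
rewrite pair_big /=.
pose h (z : T * n.-tuple T) : n.+1.-tuple T := [tuple of z.1 :: z.2].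
rewrite (reindex h) //=; exists (fun t => (thead t, [tuple of behead t])) => /=.
  by case=> a t _; congr pair; apply: val_inj.
by move=> t _; rewrite [RHS]tuple_eta; apply: val_inj.
Qed.

Lemma big_tuple_cat l m (f : seq T -> V) :
  \sum_(t : (l + m).-tuple T) f t
    = \sum_(s : l.-tuple T) \sum_(t : m.-tuple T) f (s ++ t).
Proof.
elim: l f => [|l IHl] f.
  by rewrite (big_tuple0 (fun s => \sum_(t : m.-tuple T) f (s ++ t))).
rewrite (big_tuple_cons (l + m)).
rewrite (big_tuple_cons l (fun s => \sum_(t : m.-tuple T) f (s ++ t))).
by apply: eq_bigr => a _; rewrite (IHl (fun s => f (a :: s))).
Qed.

Lemma big_tuple_eq n (f : seq T -> V) (w : seq T) : size w = n ->
  \sum_(t : n.-tuple T) (if val t == w then f t else 0) = f w.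
Proof.
move=> szw; have szw' : size w == n by apply/eqP.
rewrite (bigD1 (Tuple szw')) //= eqxx big1 ?addr0 // => t.
by rewrite -val_eqE /= => /negbTE ->.
Qed.

End TupleSums.

(** * Ascents and the lexicographic order *)

Section Words.
Variables (d : nat) (pa : 'I_d -> bool).
Local Notation L := 'I_d.

(* The bad blocks of the definition of Lambda(p|q,N) are the runs of N-1 consecutive
   ascents, where a repeated odd letter counts as an ascent. *)
Definition asc2 (a b : L) : bool := (a < b)%N || (a == b) && pa a.

(** False at the last position and beyond, so ascents occur only between two letters of the word. *)
Fixpoint asc (w : seq L) (j : nat) : bool :=
  if w is a :: w' then
    match j with
    | 0 => if w' is b :: _ then asc2 a b else false
    | j'.+1 => asc w' j'
    end
  else false.

Lemma asc_split s1 a b s2 : asc (s1 ++ a :: b :: s2) (size s1) = asc2 a b.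
Proof. by elim: s1. Qed.

Lemma asc_catl s1 s2 j : (j.+1 < size s1)%N -> asc (s1 ++ s2) j = asc s1 j.
Proof.
elim: s1 j => [|a s1 IH] [|j] //=; first by case: s1 IH.
by rewrite ltnS => /IH.
Qed.

Lemma asc_catr s1 s2 j : asc (s1 ++ s2) (size s1 + j) = asc s2 j.
Proof. by elim: s1. Qed.

Lemma word_split n j (w : seq L) : size w = n -> (j.+1 < n)%N ->
  exists s1 a b s2, [/\ w = s1 ++ a :: b :: s2, size s1 = j &
                       (size s1 + (size s2).+2 = n)%N].
Proof.
move=> <-; elim: w j => [|a w IH] [|j] //=.
  by case: w IH => [|b w] // _ _; exists [::], a, b, w.
rewrite ltnS => /IH [s1 [b [c [s2 [-> szs e]]]]].
by exists (a :: s1), b, c, s2; split=> //=; rewrite ?szs ?size_cat /= ?szs.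
Qed.

(** The word read as a number in base d: among words of equal length this is the lexicographic
    order, and inductions along it become inductions on a natural number. *)
Fixpoint valn (u : seq L) : nat :=
  if u is a :: u' then (a * d ^ size u' + valn u')%N else 0%N.

Lemma valn_lt u : (valn u < d ^ size u)%N.
Proof.
elim: u => //= a u IH; rewrite expnS.
apply: (@leq_trans (a * d ^ size u + d ^ size u)); first by rewrite ltn_add2l.
by rewrite -mulSnr leq_mul2r ltn_ord orbT.
Qed.

Lemma valn_cons_lt (a b : L) u v : size u = size v -> (a < b)%N ->
  (valn (a :: u) < valn (b :: v))%N.
Proof.
move=> e ab /=; rewrite e.
apply: (@leq_trans (a * d ^ size v + d ^ size v)).
  by rewrite ltn_add2l -e valn_lt.
by rewrite -mulSnr (leq_trans _ (leq_addr _ _)) // leq_mul2r ab orbT.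
Qed.

Lemma valn_cat u v : valn (u ++ v) = (valn u * d ^ size v + valn v)%N.
Proof.
by elim: u => //= a u ->; rewrite size_cat expnD mulnDl mulnA addnA.
Qed.

Lemma valn_inj u v : size u = size v -> valn u = valn v -> u = v.
Proof.
elim: u v => [|a u IH] [|b v] //= [e] ev.
case: (ltngtP a b) => ab.
- by have := valn_cons_lt e ab; rewrite /= ev ltnn.
- by have := valn_cons_lt (esym e) ab; rewrite /= ev ltnn.
rewrite e ab in ev *; move/addnI: ev => /(IH _ e) ->; congr cons.
exact: val_inj.
Qed.

Lemma valn_swap s1 (a b : L) s2 : (b < a)%N ->
  (valn (s1 ++ b :: a :: s2) < valn (s1 ++ a :: b :: s2))%N.
Proof.
by move=> ba; rewrite !valn_cat ltn_add2l; apply: valn_cons_lt.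
Qed.

Lemma asc2_trans : transitive asc2.
Proof.
move=> b a c; rewrite /asc2 => /orP[ab|/andP[/eqP->]].
  by case/orP=> [bc|/andP[/eqP<- _]]; rewrite ?(ltn_trans ab bc) ?ab.
by move=> pb; case/orP=> [->//|/andP[/eqP-> ->]]; rewrite eqxx orbT.
Qed.

Lemma asc2_le a b : asc2 a b -> (a <= b)%N.
Proof. by case/orP=> [/ltnW//|/andP[/eqP->]]. Qed.

Lemma sorted_even_count r a : sorted asc2 r -> ~~ pa a -> (count_mem a r <= 1)%N.
Proof.
move=> + npa; rewrite (sorted_pairwise asc2_trans).
elim: r => //= b r IH /andP[/allP ball /IH cr].
case: eqP => [eb|_] //; subst b.
rewrite (_ : count_mem a r = 0%N) //; apply/count_memPn/negP => /ball.
by rewrite /asc2 ltnn eqxx (negbTE npa).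
Qed.

(** An ascending word starts with a least letter, so a rearrangement starts with an equal or a
    larger one. This makes r the leading word of the signed sum of its rearrangements. *)
Lemma sorted_valn_min r u : sorted asc2 r -> perm_eq u r ->
  u = r \/ (valn r < valn u)%N.
Proof.
elim: r u => [|a r IH] u; first by move=> _ /perm_nilP ->; left.
case: u => [|c u] srt pe; first by move/perm_size: pe.
have le_ac : (a <= c)%N.
  have: c \in a :: r by rewrite -(perm_mem pe) mem_head.
  rewrite inE => /orP[/eqP->//|]; move: srt; rewrite /= (path_sortedE asc2_trans).
  by case/andP=> /allP h _ /h /asc2_le.
have szu : size r = size u by move/perm_size: pe => -[].
have [lt|ge] := ltnP a c; first by right; apply: valn_cons_lt.
have ac : a = c by apply/val_inj/eqP; rewrite eqn_leq le_ac.
subst c; move: pe; rewrite perm_cons => pe.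
case: (IH _ (path_sorted srt) pe) => [->|lt]; first by left.
by right; rewrite /= szu ltn_add2l.
Qed.

End Words.

(** * Antisymmetry at one position, and the vectors b_w *)

Section Adapted.
Variables (d : nat) (pa : 'I_d -> bool) (k : fieldType).
Hypothesis char0 : [pchar k] =i pred0.
Local Notation L := 'I_d.
Local Notation asc := (asc pa).

Definition eps (a b : L) : k := (-1) ^+ (pa a && pa b).

Lemma epsC a b : eps a b = eps b a.
Proof. by rewrite /eps andbC. Qed.

Lemma epsK a b : eps a b * eps a b = 1.
Proof. by rewrite -expr2 sqrr_sign. Qed.

(** Eigenvalue -1 of the adjacent transposition at j under the sign action. The size conditions make
    it vacuous for [j.+1 >= n], so quantifiers over j need no bound. *)
Definition asym (V : lmodType k) (n j : nat) (v : seq L -> V) : Prop :=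
  forall s1 a b s2, size s1 = j -> (size s1 + (size s2).+2 = n)%N ->
    v (s1 ++ b :: a :: s2) = - (eps a b *: v (s1 ++ a :: b :: s2)).

Lemma asym_prodl (V : lmodType k) m n j (f : seq L -> k^o) (g : seq L -> V) :
  asym m j f -> (j.+1 < m)%N -> (m <= n)%N ->
  asym n j (fun u => f (take m u) *: g (drop m u)).
Proof.
move=> fas jm mn s1 a b s2 szs szn.
have em : m = (size s1 + (m - j - 2).+2)%N by lia.
have szt : (size s1 + (size (take (m - j - 2) s2)).+2 = m)%N.
  rewrite size_takel; lia.
rewrite em !take_cat !drop_cat !ltnNge !leq_addr /= !addKn /= fas -?em //.
by rewrite scaleNr scalerA.
Qed.

Lemma asym_prodr (V : lmodType k) m n j (f : seq L -> k^o) (g : seq L -> V) :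
  asym n j g -> asym (m + n) (m + j) (fun u => f (take m u) *: g (drop m u)).
Proof.
move=> gas s1 a b s2 szs szn.
have mle : (m <= size s1)%N by rewrite szs leq_addr.
rewrite -(cat_take_drop m s1) -!catA.
have szt : size (take m s1) = m by rewrite size_takel.
rewrite !take_size_cat // !drop_size_cat // gas.
- by rewrite scalerN !scalerA mulrC.
- by rewrite size_drop; lia.
by rewrite size_drop; lia.
Qed.

(** For two odd letters the signature and the Koszul sign cancel, so only inversions involving an
    even letter are counted. *)
Definition inv_letter (a : L) (u : seq L) : nat :=
  count (fun b : L => (b < a)%N && ~~ (pa a && pa b)) u.

Fixpoint inv_word (u : seq L) : nat :=
  if u is a :: u' then (inv_letter a u' + inv_word u')%N else 0%N.

Lemma inv_word_swap s1 a b s2 : a != b ->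
  (-1) ^+ inv_word (s1 ++ b :: a :: s2)
    = - (eps a b * (-1) ^+ inv_word (s1 ++ a :: b :: s2)) :> k.
Proof.
move=> neq; elim: s1 => [|c s1 IH] /=.
  have hab : (a < b)%N = ~~ (b < a)%N by move: neq; rewrite -(inj_eq val_inj) /=; lia.
  rewrite /inv_letter /= hab /eps.
  case: (b < a)%N; case: (pa a); case: (pa b);
    rewrite /= ?add0n ?add1n ?addSn ?exprS ?expr1 ?expr0 ?mulN1r ?mul1r ?opprK 1?addnCA //.
rewrite !exprD {}IH !mulrN mulrCA; congr (- (_ * ((-1) ^+ _ * _))).
by rewrite /inv_letter !count_cat /= [(_ + (_ + count _ _))%N]addnCA.
Qed.

(* The signed sum of all rearrangements of r. *)
Definition run_vec (r u : seq L) : k :=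
  if perm_eq u r then (-1) ^+ inv_word u else 0.

Lemma run_vec_asym r n j : sorted (asc2 pa) r -> asym n j (run_vec r : seq L -> k^o).
Proof.
move=> srt s1 a b s2 _ _; rewrite /run_vec.
have /permPl -> : perm_eq (s1 ++ b :: a :: s2) (s1 ++ a :: b :: s2).
  by rewrite perm_cat2l; apply/seq.permP => y /=; exact: addnCA.
case: ifP => pe; last by rewrite scaler0 oppr0.
case: (altP (a =P b)) => [eab|neq]; last exact: inv_word_swap.
(* Two equal odd letters satisfy the relation trivially, as [eps] is -1; two equal even letters do
   not occur in a rearrangement of an ascending word. *)
subst b; rewrite /eps andbb; case pa_a: (pa a); first by rewrite scaleN1r opprK.
have := sorted_even_count srt (negbT pa_a).
by rewrite -(seq.permP pe) count_cat /= eqxx !addnS.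
Qed.

Lemma inv_word_sorted r : sorted (asc2 pa) r -> inv_word r = 0%N.
Proof.
elim: r => //= a r IH; rewrite (path_sortedE (asc2_trans (pa := pa))) => /andP[/allP al /IH ->].
rewrite addn0; apply/eqP; rewrite -leqn0 leqNgt -has_count; apply/hasPn => b /al /asc2_le.
by rewrite leqNgt => /negbTE ->.
Qed.

(** r is the first maximal ascending run; if w is a single run, the last clause holds because [asc]
    is false at the last position. *)
Lemma run_split w : w != [::] -> exists r w',
  [/\ w = r ++ w', r != [::], sorted (asc2 pa) r & ~~ asc w (size r).-1].
Proof.
elim: w => // a [|b w] IH _; first by exists [:: a], [::].
have [//|[|c r] [w' [//= [<- ew] _ srt nasc]]] := IH.
case ab: (asc2 pa a b); last by exists [:: a], (b :: w); split=> //; rewrite [asc _ _]ab.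
by exists (a :: b :: r), w'; split; rewrite ?ew //= ?ab // -ew.
Qed.

(** The tensor product, over the maximal ascending runs of w, of the signed sums of rearrangements.
    Ascents of w lie inside runs, whence antisymmetry; each run is least among its rearrangements,
    whence triangularity. *)
Lemma adapted_vector w : exists v : seq L -> k^o,
  [/\ forall j, asc w j -> asym (size w) j v, v w = 1 &
      forall u, size u = size w -> v u != 0 -> u = w \/ (valn w < valn u)%N].
Proof.
have [n] := ubnP (size w); elim: n w => // n IH w; rewrite ltnS => szw.
case: (altP (w =P [::])) => [->|wn0].
  by exists (fun=> 1); split=> // u /size0nil ->; left.
have [r [w' [ew rn0 srt nasc]]] := run_split wn0.
have rpos : (0 < size r)%N by rewrite lt0n size_eq0.
have [|v' [v'as v'w v'u]] := IH w'.
  by apply: leq_trans szw; rewrite ew size_cat -[ltnLHS]add0n ltn_add2r.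
exists (fun u => run_vec r (take (size r) u) *: v' (drop (size r) u)); split.
- move=> j ascj; rewrite ew size_cat.
  case: (ltngtP j.+1 (size r)) => jr.
  + by apply: asym_prodl; rewrite ?leq_addr //; apply: run_vec_asym.
  + have {jr} jr : (size r <= j)%N by rewrite -ltnS.
    rewrite -(subnKC jr); apply: asym_prodr; apply: v'as.
    by move: ascj; rewrite ew -{1}(subnKC jr) asc_catr.
  by move: nasc; rewrite -jr /= ascj.
- rewrite ew take_size_cat // drop_size_cat // v'w /run_vec perm_refl.
  by rewrite inv_word_sorted // scale1r.
move=> u; rewrite ew size_cat => szu.
have : size (drop (size r) u) = size w' by rewrite size_drop szu addKn.
have : size (take (size r) u) = size r by rewrite size_takel // szu leq_addr.
move: (cat_take_drop (size r) u).
move: (take _ u) (drop _ u) => u1 u2 <- sz1 sz2.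
rewrite scaler_eq0 negb_or /run_vec; case: ifP => [pe|]; last by rewrite eqxx.
case/andP=> _ /(v'u _ sz2) v2.
case: (sorted_valn_min srt pe) => [->|lt1].
  case: v2 => [->|lt2]; [by left|right].
  by rewrite !valn_cat sz2 ltn_add2l.
right; rewrite !valn_cat sz2.
apply: (@leq_trans (valn r * d ^ size w' + d ^ size w')).
  by rewrite ltn_add2l valn_lt.
by rewrite -mulSnr (leq_trans _ (leq_addr _ _)) // leq_mul2r lt1 orbT.
Qed.

(* An antisymmetric vector has an ascent at j in its least word: otherwise swapping the
   two letters gives a smaller word, or the same word with opposite sign. *)
Lemma asym_leading (V : lmodType k) n j (v : seq L -> V) u :
  asym n j v -> size u = n -> (j.+1 < n)%N -> v u != 0 ->
  (forall u', size u' = n -> (valn u' < valn u)%N -> v u' = 0) -> asc u j.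
Proof.
move=> vas szu jn vu min.
have [s1 [a [b [s2 [eu szs szn]]]]] := word_split szu jn.
rewrite eu -szs asc_split; apply: contraT; rewrite /asc2 negb_or -leqNgt leq_eqVlt.
have sw := vas s1 a b s2 szs szn; rewrite -eu in sw.
case/andP=> /orP[/eqP/val_inj eba|lt].
  subst b; rewrite eqxx /= => npa; rewrite -eu /eps (negbTE npa) scale1r in sw.
  move: vu; have: 2%:R *: v u == 0 by rewrite scaler_nat mulr2n {1}sw addNr.
  by rewrite scaler_eq0 ((pcharf0P k).1 char0) /= => ->.
move=> _; move: sw; rewrite min ?eu; last exact: valn_swap.
  move/eqP; rewrite eq_sym oppr_eq0 scaler_eq0 signr_eq0 /= -eu => /eqP v0.
  by rewrite v0 eqxx in vu.
by rewrite size_cat.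
Qed.

End Adapted.

(** * Expansion in the adapted basis *)

Section AdaptedBasis.
Variables (d : nat) (pa : 'I_d -> bool) (k : fieldType).
Hypothesis char0 : [pchar k] =i pred0.
Local Notation L := 'I_d.
Local Notation asc := (asc pa).
Local Notation asym := (asym pa).

(** Column w of [be] is b_w, and [ga] is the inverse matrix. [adapted_coord] is the spanning
    property in coordinates; its tensors take values in an arbitrary module so that it also applies
    to those with values in [B]. *)
Record adapted_basis (n : nat) (be ga : seq L -> seq L -> k) : Prop := AdaptedBasis {
  adapted_mulr : forall u w : n.-tuple L, \sum_(t : n.-tuple L) be u t * ga t w = (u == w)%:R;
  adapted_mull : forall u w : n.-tuple L, \sum_(t : n.-tuple L) ga u t * be t w = (u == w)%:R;
  adapted_asym : forall w j, size w = n -> asc w j -> asym n j (be^~ w : seq L -> k^o);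
  adapted_diag : forall w, size w = n -> be w w = 1;
  adapted_low : forall u w, size u = n -> size w = n -> be u w != 0 ->
    u = w \/ (valn w < valn u)%N;
  adapted_coord : forall (V : lmodType k) (v : seq L -> V) j (w : n.-tuple L),
    asym n j v -> (j.+1 < n)%N -> ~~ asc w j ->
    \sum_(t : n.-tuple L) ga w t *: v t = 0
}.

Lemma adapted_unique (V : lmodType k) n (be : seq L -> seq L -> k) (c : n.-tuple L -> V) :
  (forall w, size w = n -> be w w = 1) ->
  (forall u w, size u = n -> size w = n -> be u w != 0 -> u = w \/ (valn w < valn u)%N) ->
  (forall u : n.-tuple L, \sum_(w : n.-tuple L) be u w *: c w = 0) ->
  forall w, c w = 0.
Proof.
move=> diag low sum0 w; have [m] := ubnP (valn w); elim: m w => // m IH w; rewrite ltnS => lm.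
rewrite -(sum0 w) (bigD1 w) //= diag ?size_tuple // scale1r big1 ?addr0 // => t tw.
have [->|bn0] := eqVneq (be w t) 0; first by rewrite scale0r.
case: (low _ _ (size_tuple w) (size_tuple t) bn0) => [/val_inj e|lt].
  by rewrite e eqxx in tw.
by rewrite IH ?scaler0 // (leq_trans lt).
Qed.

(** Gaussian elimination from the least word upwards. By [asym_leading] the least word u0 of the
    support has an ascent at each j in J, so subtracting a multiple of b_u0 does not leave the space
    of tensors antisymmetric at J. *)
Lemma adapted_expansion (V : lmodType k) n (be : seq L -> seq L -> k)
    (J : nat -> Prop) (v : seq L -> V) :
  (forall w, size w = n -> be w w = 1) ->
  (forall w j, size w = n -> asc w j -> asym n j (be^~ w : seq L -> k^o)) ->
  (forall u w, size u = n -> size w = n -> be u w != 0 -> u = w \/ (valn w < valn u)%N) ->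
  (forall j, J j -> asym n j v) ->
  exists c : seq L -> V,
    (forall w j, size w = n -> J j -> (j.+1 < n)%N -> ~~ asc w j -> c w = 0) /\
    (forall u : n.-tuple L, v u = \sum_(w : n.-tuple L) be u w *: c w).
Proof.
move=> diag basym low vas.
have: forall u, size u = n -> (valn u < d ^ n - d ^ n)%N -> v u = 0.
  by rewrite subnn.
have: (d ^ n <= d ^ n)%N by [].
(* Induction on m, where the support of v consists of words of value at least d ^ n - m. *)
move: {1 4}(d ^ n)%N => m; elim: m v vas => [|m IH] v vas mle v0.
  exists (fun=> 0); split=> // u; rewrite big1 => [|w _]; last by rewrite scaler0.
  by rewrite v0 ?size_tuple // subn0 -[X in (_ < _ ^ X)%N](size_tuple u) valn_lt.
case: (pselect (exists u : seq L, size u = n /\ valn u = d ^ n - m.+1)%N) => [[u0 [szu0 eu0]]|no].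
  have asc0 j : J j -> (j.+1 < n)%N -> v u0 != 0 -> asc u0 j.
    move=> Jj jn vn0; apply: (asym_leading char0 (vas j Jj)) => // u' su lt.
    by apply: v0; rewrite // -eu0.
  pose v' u := v u - be u u0 *: v u0.
  have v'as j : J j -> asym n j v'.
    move=> Jj s1 a b s2 szs szn; rewrite /v' (vas j Jj) //.
    have [vz|vn0] := eqVneq (v u0) 0; first by rewrite vz !scaler0 !subr0.
    rewrite (basym u0 j szu0 _ s1) //; last by apply: asc0 => //; lia.
    by rewrite scalerBr opprB scaleNr opprK -scalerA addrC.
  have v'0 u : size u = n -> (valn u < d ^ n - m)%N -> v' u = 0.
    move=> szu ltu; rewrite /v'.
    have [e|neq] := eqVneq u u0; first by rewrite e diag // scale1r subrr.
    have neqv : valn u != valn u0.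
      by apply: contra neq => /eqP e; apply/eqP/valn_inj; rewrite ?szu.
    rewrite v0 // ?sub0r; last by rewrite -eu0; lia.
    have [->|bn0] := eqVneq (be u u0) 0; first by rewrite scale0r oppr0.
    case: (low _ _ szu szu0 bn0) => [e|lt]; first by rewrite e eqxx in neq.
    by exfalso; lia.
  have [|c [c0 cv]] := IH v' v'as _ v'0; first by lia.
  exists (fun w => c w + (if w == u0 then v u0 else 0)); split.
    move=> w j szw Jj jn nas; rewrite (c0 w j) // add0r.
    case: eqP => // e; apply/eqP; apply: contraR nas; rewrite e.
    exact: asc0.
  move=> u; under eq_bigr do rewrite scalerDr.
  rewrite big_split /= -cv.
  rewrite (eq_bigr (fun w : n.-tuple L => if val w == u0 then be u w *: v u0 else 0)).
    by rewrite (big_tuple_eq (fun w => be u w *: v u0)) // /v' subrK.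
  by move=> w _; case: ifP => //; rewrite scaler0.
apply: IH => //; first by lia.
move=> u szu ltu; apply: v0 => //; rewrite ltn_neqAle; apply/andP; split; last by lia.
by apply/eqP => e; apply: no; exists u.
Qed.

Lemma adapted_basis_exists n : exists be ga, adapted_basis n be ga.
Proof.
have [b bP] := choice (adapted_vector pa k).
pose be u w := b w u : k.
have diag w : size w = n -> be w w = 1 by move=> _; have [] := bP w.
have basym w j : size w = n -> asc w j -> asym n j (be^~ w : seq L -> k^o).
  by move=> <-; have [+ _ _] := bP w; apply.
have low u w : size u = n -> size w = n -> be u w != 0 -> u = w \/ (valn w < valn u)%N.
  by move=> szu szw; have [_ _] := bP w; apply; rewrite szu.
(* Expanding single words, with no antisymmetry required, gives a right inverse of [be]; by
   triangularity it is also a left inverse. *)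
have ex (w0 : seq L) : exists c : seq L -> k, forall u : n.-tuple L,
    (val u == w0)%:R = \sum_(w : n.-tuple L) be u w * c w.
  have [|c [_ cP]] := @adapted_expansion k^o n be (fun=> False)
    (fun u => (u == w0)%:R) diag basym low; first by [].
  by exists c.
have [g gP] := choice ex.
pose ga w w0 := g w0 w.
have mulr (u w : n.-tuple L) : \sum_(t : n.-tuple L) be u t * ga t w = (u == w)%:R.
  by rewrite -gP.
have mull (u w : n.-tuple L) : \sum_(t : n.-tuple L) ga u t * be t w = (u == w)%:R.
  apply/eqP; rewrite -subr_eq0; apply/eqP.
  pose c (u : n.-tuple L) : k^o := \sum_(t : n.-tuple L) ga u t * be t w - (u == w)%:R.
  apply: (@adapted_unique k^o n be c diag low _ u) => {}u; rewrite /c.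
  under eq_bigr do rewrite scalerBr.
  rewrite sumrB; apply/eqP; rewrite subr_eq0; apply/eqP.
  rewrite [RHS](bigD1 w) //= [X in _ = _ + X]big1 ?addr0; last first.
    by move=> t /negbTE ->; rewrite scaler0.
  rewrite eqxx [RHS]mulr1.
  under eq_bigr do rewrite scaler_sumr.
  rewrite exchange_big /= (bigD1 u) //= [X in _ + X]big1 ?addr0; last first.
    move=> t tu; under eq_bigr do rewrite [_ *: _]mulrA.
    by rewrite -mulr_suml mulr eq_sym (negbTE tu) mul0r.
  under eq_bigr do rewrite [_ *: _]mulrA.
  by rewrite -mulr_suml mulr eqxx mul1r.
exists be, ga; split=> // V v j w vas jn nas.
have [|c [c0 cv]] := @adapted_expansion V n be (eq j) v diag basym low; first by move=> _ <-.
rewrite (eq_bigr (fun t : n.-tuple L =>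
   \sum_(s : n.-tuple L) (ga w t * be t s) *: c s)); last first.
  by move=> t _; rewrite cv scaler_sumr; apply: eq_bigr => s _; rewrite scalerA.
rewrite exchange_big /= big1 // => s _; rewrite -scaler_suml mull.
by case: eqP => [<-|]; rewrite ?scale0r // (c0 w j) ?size_tuple ?scaler0.
Qed.

End AdaptedBasis.

(** * The antisymmetrizer and Newton's identities *)

Section Antisymmetrizer.
Variables (d : nat) (pa : 'I_d -> bool) (k : fieldType).
Hypothesis char0 : [pchar k] =i pred0.
Local Notation L := 'I_d.
Local Notation eps := (eps pa k).
Local Notation asym := (asym pa).

(* (alt_shuffle u v) is the sum over j of (-1)^j (s_{j-1} ... s_1 s_0 v)(u), for the sign
   action of the adjacent transpositions: the coset sum from S_{n-1} to S_n. *)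
Fixpoint alt_shuffle (V : lmodType k) (u : seq L) (v : seq L -> V) : V :=
  if u is a :: u' then
    v u - alt_shuffle u' (fun y => if y is b :: z then eps a b *: v (b :: a :: z) else 0)
  else 0.

Lemma asym_cons (V : lmodType k) n j a (v : seq L -> V) :
  asym n.+1 j.+1 v -> asym n j (fun y => v (a :: y)).
Proof.
by move=> vas s1 b c s2 szs szn; apply: (vas (a :: s1)); rewrite /= ?addSn ?szn ?szs.
Qed.

Lemma alt_shuffle_cons (V : lmodType k) a u (v : seq L -> V) :
  alt_shuffle (a :: u) v = v (a :: u) - alt_shuffle u
    (fun y => if y is b :: z then eps a b *: v (b :: a :: z) else 0).
Proof. by []. Qed.

Lemma eq_alt_shuffle (V : lmodType k) u (v v' : seq L -> V) :
  (forall y, size y = size u -> v y = v' y) -> alt_shuffle u v = alt_shuffle u v'.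
Proof.
elim: u v v' => //= a u IH v v' e; rewrite e //; congr (_ - _); apply: IH => -[|b z] //= sz.
by rewrite e //= -sz.
Qed.

Lemma alt_shuffle_sum (V : lmodType k) (I : finType) u (v : I -> seq L -> V) :
  alt_shuffle u (fun y => \sum_i v i y) = \sum_i alt_shuffle u (v i).
Proof.
elim: u v => [|a u IH] v /=; first by rewrite big1.
rewrite sumrB -IH; congr (_ - _); apply: eq_alt_shuffle => -[|b z] _; first by rewrite big1.
by rewrite scaler_sumr.
Qed.

Lemma alt_shuffleZ (V : lmodType k) u c (v : seq L -> V) :
  alt_shuffle u (fun y => c *: v y) = c *: alt_shuffle u v.
Proof.
elim: u v => [|a u IH] v /=; first by rewrite scaler0.
rewrite scalerBr -IH; congr (_ - _); apply: eq_alt_shuffle => -[|b z] _; first by rewrite scaler0.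
by rewrite !scalerA mulrC.
Qed.

Lemma alt_shuffle_scale (V : lmodType k) u (f : seq L -> k^o) (x : V) :
  (alt_shuffle u f : k) *: x = alt_shuffle u (fun y => (f y : k) *: x).
Proof.
elim: u f => [|a u IH] f /=; first by rewrite scale0r.
rewrite scalerBl IH; congr (_ - _); apply: eq_alt_shuffle => -[|b z] _; first by rewrite scale0r.
by rewrite scalerA.
Qed.

(** A signed coset sum turns antisymmetry under S_{n-1}, acting from position 1 on, into
    antisymmetry under S_n. The only new exchange is that of the first two letters: it swaps the
    first two terms, and the others change sign by antisymmetry of v at position 1. *)
Lemma alt_shuffle_asym (V : lmodType k) n (v : seq L -> V) :
  (forall j, asym n j.+1 v) -> forall j, asym n j (alt_shuffle (V := V) ^~ v).
Proof.
elim: n v => [|n IH] v vas j s1 a b s2 szs szn; first by lia.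
case: s1 szs szn => [|c s1] /= szs szn; last first.
  have [jE nE] : size s1 = j.-1 /\ (size s1 + (size s2).+2 = n)%N by lia.
  have -> := vas j.-1 (c :: s1) a b s2 _ szn; last by rewrite /= jE.
  rewrite (IH _ _ _ s1 _ _ _ erefl nE) ?scalerBr ?opprB; first by rewrite opprK addrC.
  move=> i [|e t1] x y t2 //= [szt] sztn.
  have -> := vas i.+1 (e :: c :: t1) x y t2; [|by rewrite /= szt|by rewrite /=; lia].
  by rewrite scalerN !scalerA mulrC.
have -> : alt_shuffle s2 (fun y => if y is b0 :: z
     then eps a b0 *: (eps b b0 *: v [:: b0, b, a & z]) else 0) =
   - (eps a b *: alt_shuffle s2 (fun y => if y is b0 :: z
     then eps b b0 *: (eps a b0 *: v [:: b0, a, b & z]) else 0)).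
  rewrite -scaleNr -alt_shuffleZ; apply: eq_alt_shuffle => -[|c z] sz; first by rewrite scaler0.
  have -> := vas 0%N [:: c] a b z erefl; last by rewrite /= -szn -sz.
  by rewrite !scalerN scaleNr !scalerA; congr (- (_ *: _)); rewrite mulrC; congr (_ * _); rewrite mulrC.
rewrite (epsC _ _ b a) opprK !scalerBr scalerA epsK scale1r opprB opprD.
by rewrite addrA addrAC.
Qed.

Lemma alt_shuffle_id (V : lmodType k) n (v : seq L -> V) u :
  (forall j, asym n j v) -> size u = n -> alt_shuffle u v = n%:R *: v u.
Proof.
elim: n v u => [|n IH] v [|a u] // vas; first by rewrite scale0r.
rewrite alt_shuffle_cons; case: u => [|b u] [szu]; first by rewrite -szu /= subr0 scale1r.
rewrite (eq_alt_shuffle (v' := fun y => -1 *: v (a :: y))); last first.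
  move=> [|c z] // [sz]; have -> := vas 0%N [::] a c z erefl; last by move: szu => /=; lia.
  by rewrite scalerN scalerA epsK scaleN1r scale1r.
rewrite alt_shuffleZ (IH (fun y => v (a :: y))) //.
  by rewrite scaleN1r opprK mulrS scalerDl scale1r.
by move=> j; apply: asym_cons.
Qed.

(** As in a cyclic trace, each coset representative can be moved to the second argument of G, where
    antisymmetry absorbs it with its sign; the n terms become equal. *)
Lemma alt_shuffle_trace (V : lmodType k) n (G : seq L -> seq L -> V) :
  (forall y j, size y = n -> asym n j (G y)) ->
  \sum_(u : n.-tuple L) alt_shuffle u (G ^~ u) = n%:R *: \sum_(u : n.-tuple L) G u u.
Proof.
elim: n G => [|n IH] G Gas.
  by rewrite scale0r big1 // => u _; rewrite tuple0.
pose H a y u := if y is b :: z then eps a b *: G (b :: a :: z) (a :: u) else 0.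
have HE a : \sum_(u : n.-tuple L) alt_shuffle u (H a ^~ u)
    = n%:R *: \sum_(u : n.-tuple L) H a u u.
  apply: IH => -[|b z] j szy s1 x y s2 szs szn /=; first by rewrite scaler0 oppr0.
  rewrite (Gas _ j.+1 _ (a :: s1)) //=; [|by rewrite -szy|by rewrite szs|by rewrite addSn szn].
  by rewrite scalerN !scalerA mulrC.
rewrite (big_tuple_cons n (fun u => alt_shuffle u (G ^~ u))).
rewrite (big_tuple_cons n (fun u => G u u)).
under eq_bigr => a _ do rewrite /= sumrB HE.
rewrite sumrB mulrSr scalerDl scale1r addrC; congr (_ + _).
rewrite -scaler_sumr -scalerN.
have [->|npos] := posnP n; first by rewrite !scale0r.
rewrite -(prednK npos) in Gas *; move: n.-1 Gas => {npos IH HE} {}n Gas; congr (_ *: _).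
under eq_bigr => a _ do rewrite (big_tuple_cons n (fun u => H a u u)).
under [RHS]eq_bigr => a _ do rewrite (big_tuple_cons n (fun u => G (a :: u) (a :: u))).
rewrite exchange_big /= -sumrN; apply: eq_bigr => b _; rewrite -sumrN; apply: eq_bigr => a _.
rewrite -sumrN; apply: eq_bigr => u _.
rewrite (Gas _ 0%N _ [::] b a u) //= ?size_tuple //.
by rewrite scalerN opprK scalerA (epsC _ _ b) epsK scale1r.
Qed.

(** The recursion over cosets: 1/n times the signed coset sum, applied to the identity on the first
    factor tensored with the antisymmetrizer of the others. Newton's recursion peels off exactly
    this outer sum. *)
Fixpoint antisymmetrizer (u w : seq L) : k :=
  if w is c :: w' then
    (size u)%:R^-1 * alt_shuffle (V := k^o) u
      (fun y => if y is a :: y' then (if a == c then antisymmetrizer y' w' else 0) else 0)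
  else (u == [::])%:R.
Local Notation Y := antisymmetrizer.

Let natn0 n : n.+1%:R != 0 :> k.
Proof. by rewrite ((pcharf0P k).1 char0). Qed.

Lemma antisymmetrizer_asyml n w j : size w = n -> asym n j (Y ^~ w : seq L -> k^o).
Proof.
elim: w n j => [|c w IH] n j szw s1 a b s2 szs szn; first by move: szn szw => /=; lia.
rewrite -[Y (s1 ++ b :: a :: s2) _]/(_ * _) -[Y (s1 ++ a :: b :: s2) _]/(_ * _).
rewrite (@alt_shuffle_asym _ n _ _ j s1) //; last first.
  move=> i [|e t1] x y t2 //= [szt] sztn; case: eqP => _; last by rewrite scaler0 oppr0.
  apply: (IH n.-1 i) => //; first by rewrite -szw.
  by lia.
by rewrite mulrN !size_cat /= scalerAr.
Qed.

Lemma antisymmetrizer_id (V : lmodType k) n (v : seq L -> V) u :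
  (forall j, asym n j v) -> size u = n -> \sum_(w : n.-tuple L) Y u w *: v w = v u.
Proof.
elim: n v u => [|n IH] v u vas szu.
  by rewrite (big_tuple0 (fun w => Y u w *: v w)) (size0nil szu) /= scale1r.
rewrite (big_tuple_cons n (fun w => Y u w *: v w)) /=.
under eq_bigr => c _ do under eq_bigr => w _ do rewrite -scalerA alt_shuffle_scale.
under eq_bigr do rewrite -scaler_sumr -alt_shuffle_sum.
rewrite -scaler_sumr -alt_shuffle_sum (eq_alt_shuffle (v' := v)).
  by rewrite (alt_shuffle_id vas) // scalerA szu mulVf ?natn0 ?scale1r.
move=> [|a y] sz; first by rewrite szu in sz.
rewrite (bigD1 a) //= [X in _ + X]big1 ?addr0; last first.
  by move=> c /negbTE ca; rewrite big1 // => w _; rewrite eq_sym ca scale0r.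
rewrite eqxx (IH (fun y => v (a :: y))) //; last by move: sz; rewrite szu => -[].
by move=> j; apply: asym_cons.
Qed.

(** The coset sum now acts on the summation index w, and [alt_shuffle_trace] transfers it to the
    antisymmetric v. *)
Lemma antisymmetrizer_trid (V : lmodType k) n (v : seq L -> V) u :
  (forall j, asym n j v) -> size u = n -> \sum_(w : n.-tuple L) Y w u *: v w = v u.
Proof.
elim: n v u => [|n IH] v u vas szu.
  by rewrite (big_tuple0 (fun w => Y w u *: v w)) (size0nil szu) /= scale1r.
case: u szu => // c u [szu].
pose f y : k := if y is a :: y' then (if a == c then Y y' u else 0) else 0.
rewrite (eq_bigr (fun w : n.+1.-tuple L => n.+1%:R^-1 *: alt_shuffle w (fun y => f y *: v w))); last first.
  by move=> w _; rewrite /= size_tuple -scalerA alt_shuffle_scale.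
rewrite -scaler_sumr (alt_shuffle_trace (G := fun y w => f y *: v w)); last first.
  move=> y j _ s1 a b s2 szs szn; rewrite (vas j) // scalerN !scalerA mulrC //.
rewrite scalerA mulVf ?natn0 // scale1r (big_tuple_cons n (fun w => f w *: v w)).
rewrite (bigD1 c) //= [X in _ + X]big1 ?addr0; last first.
  by move=> a /negbTE ac; rewrite big1 // => w _; rewrite ac scale0r.
rewrite eqxx (IH (fun y => v (c :: y))) //.
by move=> j; apply: asym_cons.
Qed.

(* Writing Y for the antisymmetrizer, Y^T Y = Y because Y^T is also the identity on
   antisymmetric vectors; hence Y is symmetric. *)
Lemma antisymmetrizer_sym n u w : size u = n -> size w = n -> Y u w = Y w u.
Proof.
move=> szu szw.
have E a b : size a = n -> size b = n -> \sum_(t : n.-tuple L) Y t a * Y t b = Y a b.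
  move=> sza szb; apply: (@antisymmetrizer_trid k^o n (Y ^~ b)) => // j.
  exact: antisymmetrizer_asyml.
by rewrite -(E u w) // -(E w u) //; apply: eq_bigr => t _; rewrite mulrC.
Qed.

Lemma antisymmetrizer_asymr n u j : size u = n -> asym n j (Y u : seq L -> k^o).
Proof.
move=> szu s1 a b s2 szs szn.
rewrite !(@antisymmetrizer_sym n u) ?size_cat //=.
exact: (antisymmetrizer_asyml (n := n)).
Qed.

End Antisymmetrizer.

(** * The coaction, its supertraces, and Newton's recursion *)

Section SuperTrace.
Variables (d : nat) (pa : 'I_d -> bool) (k : fieldType).
Hypothesis char0 : [pchar k] =i pred0.
Local Notation L := 'I_d.
Local Notation eps := (eps pa k).
Local Notation asym := (asym pa).
Local Notation Y := (antisymmetrizer pa k).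

(** Commutation of a kernel with the adjacent transposition at j, as invariance under a simultaneous
    exchange in both arguments. *)
Definition equivariant (V : lmodType k) n j (K : seq L -> seq L -> V) : Prop :=
  forall s1 a b s2 t1 c e t2, size s1 = j -> size t1 = j ->
    (size s1 + (size s2).+2 = n)%N -> (size t1 + (size t2).+2 = n)%N ->
    K (s1 ++ b :: a :: s2) (t1 ++ e :: c :: t2)
      = (eps a b * eps c e) *: K (s1 ++ a :: b :: s2) (t1 ++ c :: e :: t2).

Lemma big_tuple_split (V : lmodType k) j m (f : seq L -> V) :
  \sum_(t : (j + m.+2).-tuple L) f t
    = \sum_(s1 : j.-tuple L) \sum_a \sum_b \sum_(s2 : m.-tuple L) f (s1 ++ a :: b :: s2).
Proof.
rewrite big_tuple_cat; apply: eq_bigr => s1 _.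
rewrite (big_tuple_cons m.+1 (fun t => f (s1 ++ t))); apply: eq_bigr => a _.
by rewrite (big_tuple_cons m (fun t => f (s1 ++ a :: t))).
Qed.

Lemma equivariant_suml (V : lmodType k) n j (f : seq L -> k^o) (K : seq L -> seq L -> V) :
  equivariant n j K -> asym n j f ->
  asym n j (fun w => \sum_(u : n.-tuple L) (f u : k) *: K w u).
Proof.
move=> Keq fas s1 a b s2 szs szn.
have nE : n = (j + (size s2).+2)%N by rewrite -szs.
subst n; rewrite (big_tuple_split _ _ (fun u => (f u : k) *: K (s1 ++ b :: a :: s2) u)).
rewrite (big_tuple_split _ _ (fun u => (f u : k) *: K (s1 ++ a :: b :: s2) u)) scaler_sumr -sumrN.
apply: eq_bigr => t1 _; rewrite exchange_big /= scaler_sumr -sumrN.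
apply: eq_bigr => c _; rewrite scaler_sumr -sumrN.
apply: eq_bigr => e _; rewrite scaler_sumr -sumrN.
apply: eq_bigr => t2 _; rewrite fas ?size_tuple // Keq ?size_tuple //.
rewrite scaleNr !scalerA; congr (- (_ *: _)).
by rewrite [_ *: _]mulrC -mulrA (mulrCA (eps c e)) epsK mulr1 mulrC.
Qed.

Lemma equivariant_sumr (V : lmodType k) n j (f : seq L -> k^o) (K : seq L -> seq L -> V) :
  equivariant n j K -> asym n j f ->
  asym n j (fun u => \sum_(w : n.-tuple L) (f w : k) *: K w u).
Proof.
move=> Keq fas; apply: (equivariant_suml (K := fun u w => K w u)) => //.
move=> s1 a b s2 t1 c e t2 h1 h2 h3 h4; rewrite Keq //; congr (_ *: _); exact: mulrC.
Qed.

Definition parity_word (w : seq L) : bool := foldr (fun a => addb (pa a)) false w.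
Local Notation pw := parity_word.

Lemma parity_word_cat s t : pw (s ++ t) = pw s (+) pw t.
Proof. by elim: s => //= a s ->; rewrite addbA. Qed.

Variables (B : algType k) (x : L -> L -> B).

Definition supercommutes (M : L -> L -> B) : Prop := forall a b c e,
  M a b * x c e = (-1) ^+ ((pa a (+) pa b) && (pa c (+) pa e)) *: (x c e * M a b).

Hypothesis xC : supercommutes x.

(** One step of [coaction] with the first entry taken from [M] in place of [x]: Newton's recursion
    puts powers of X there. *)
Definition super_cons (M : L -> L -> B) (K : seq L -> seq L -> B) (w i : seq L) : B :=
  match w, i with
  | a :: w', c :: i' => (-1) ^+ (pa c (+) ((pa a (+) pa c) && pw w')) *: (M a c * K w' i')
  | _, _ => 0
  end.

(* The coaction on V^{\otimes n}, with column i multiplied by the parity sign of x_i: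
   ordinary traces against it are supertraces. *)
Fixpoint coaction (w i : seq L) : B :=
  match w, i with
  | [::], [::] => 1
  | a :: w', c :: i' =>
    (-1) ^+ (pa c (+) ((pa a (+) pa c) && pw w')) *: (x a c * coaction w' i')
  | _, _ => 0
  end.
Local Notation T := coaction.

(** The sign comes from moving the entries for s and t past the letters of s'; it disappears when s
    and t have the same parity. *)
Lemma coaction_cat s t s' t' : size s = size t ->
  T (s ++ s') (t ++ t') = (-1) ^+ ((pw s (+) pw t) && pw s') *: (T s t * T s' t').
Proof.
elim: s t => [|a s IH] [|c t] //= => [_|[sz]]; first by rewrite mul1r scale1r.
rewrite IH // parity_word_cat -!scalerAl -!scalerAr !scalerA mulrA; congr (_ *: _).
rewrite -!signr_addb; congr (_ ^+ nat_of_bool _).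
by case: (pa a); case: (pa c); case: (pw s); case: (pw t); case: (pw s').
Qed.

(** Splitting off the letters before j reduces the claim to two letters, where it is the
    supercommutation of two entries. *)
Lemma coaction_equivariant n j : equivariant n j T.
Proof.
move=> s1 a b s2 t1 c e t2 szs szt szn1 szn2; rewrite !coaction_cat ?szs //.
rewrite (_ : pw (b :: a :: s2) = pw (a :: b :: s2)); last by rewrite /= addbCA.
rewrite scalerA mulrC -scalerA; congr (_ *: _); rewrite scalerAr; congr (_ * _).
rewrite /= -!scalerAr !scalerA !mulrA (xC b e) -!scalerAl !scalerA; congr (_ *: _).
rewrite /eps -!signr_addb; congr (_ ^+ nat_of_bool _).
by case: (pa a); case: (pa c); case: (pa b); case: (pa e); case: (pw s2).
Qed.

(** Exchanging letters preserves the parity of a word, so a factor depending on it is harmless; the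
    sign in [super_cons] is of this kind. *)
Lemma coaction_sign_equivariant n j (f : bool -> k) :
  equivariant n j (fun w i => f (pw w) *: T w i).
Proof.
move=> s1 a b s2 t1 c e t2 szs szt szn1 szn2; rewrite (coaction_equivariant _ _ _ _ szs szt szn1 szn2).
rewrite !scalerA mulrC; congr (_ * f _ *: _).
by rewrite !parity_word_cat /= [pa b (+) (_ (+) _)]addbCA.
Qed.

Definition ext_trace n : B :=
  \sum_(u : n.-tuple L) \sum_(w : n.-tuple L) Y u w *: T w u.

Definition ext_trace_with n (M : L -> L -> B) : B :=
  \sum_(u : n.-tuple L) \sum_(w : n.-tuple L) Y u w *: super_cons M T w u.

Definition supertrace (M : L -> L -> B) : B := \sum_a (-1) ^+ pa a *: M a a.

Definition mulX (M : L -> L -> B) (a b : L) : B := \sum_c x a c * M c b.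

Lemma ext_trace0 : ext_trace 0 = 1.
Proof.
rewrite /ext_trace (big_tuple0 (fun u => \sum_(w : 0.-tuple L) Y u w *: T w u)).
by rewrite (big_tuple0 (fun w => Y [::] w *: T w [::])) /= scale1r.
Qed.

Lemma ext_traceS n : ext_trace n.+1 = ext_trace_with n.+1 x.
Proof.
apply: eq_bigr => u _; apply: eq_bigr => w _.
by rewrite [in LHS](tuple_eta u) [in LHS](tuple_eta w) [in RHS](tuple_eta u) [in RHS](tuple_eta w).
Qed.

Let natn0 n : n.+1%:R != 0 :> k.
Proof. by rewrite ((pcharf0P k).1 char0). Qed.

(* Expanding the antisymmetrizer along cosets of the stabilizer of the first letter, all
   nontrivial cosets contribute equally: each glues X onto M. *)
Lemma newton_step n (M : L -> L -> B) : supercommutes M ->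
  n.+1%:R *: ext_trace_with n.+1 M
    = supertrace M * ext_trace n - n%:R *: ext_trace_with n (mulX M).
Proof.
move=> MC.
pose g y u := if y is a :: y' then
  \sum_(w : n.-tuple L) Y y' w *: super_cons M T (a :: w) u else 0.
have -> : n.+1%:R *: ext_trace_with n.+1 M = \sum_(u : n.+1.-tuple L) alt_shuffle pa u (g ^~ u).
  rewrite scaler_sumr; apply: eq_bigr => u _.
  rewrite (big_tuple_cons n (fun w => Y u w *: super_cons M T w u)) /= size_tuple.
  under eq_bigr => c _ do under eq_bigr => w _ do rewrite -scalerA alt_shuffle_scale.
  under eq_bigr do rewrite -scaler_sumr -alt_shuffle_sum.
  rewrite -scaler_sumr -alt_shuffle_sum scalerA mulfV ?natn0 // scale1r.
  apply: eq_alt_shuffle => -[|a y] _; first by rewrite big1 // => c _; rewrite big1 // => w _; rewrite scale0r.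
  rewrite (bigD1 a) //= [X in _ + X]big1 ?addr0.
    by apply: eq_bigr => w _; rewrite eqxx.
  by move=> c /negbTE ca; rewrite big1 // => w _; rewrite eq_sym ca scale0r.
(* All nontrivial representatives start by exchanging the first two factors, so together they form a
   coset sum over the letters after the first. *)
pose H a y u := if y is b :: z then eps a b *: g (b :: a :: z) (a :: u) else 0.
have HE a : \sum_(u : n.-tuple L) alt_shuffle pa u (H a ^~ u)
    = n%:R *: \sum_(u : n.-tuple L) H a u u.
  apply: alt_shuffle_trace => -[|b z] j szy s1 c e s2 szs szn /=; first by rewrite scaler0 oppr0.
  pose f w := (-1) ^+ (pa a (+) ((pa b (+) pa a) && w)) : k.
  have E s : \sum_(w : n.-tuple L) Y (a :: z) w *:
       ((-1) ^+ (pa a (+) (pa b (+) pa a) && pw w) *: (M b a * T w s))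
     = M b a * \sum_(w : n.-tuple L) Y (a :: z) w *: (f (pw w) *: T w s).
    by rewrite mulr_sumr; apply: eq_bigr => w _; rewrite !scalerAr.
  have A := equivariant_sumr (@coaction_sign_equivariant n j f)
    (@antisymmetrizer_asymr _ pa _ char0 n (a :: z) j szy).
  by rewrite !E A // mulrN -scalerAr scalerN !scalerA mulrC.
rewrite (big_tuple_cons n (fun u => alt_shuffle pa u (g ^~ u))).
under eq_bigr => a _ do rewrite /= sumrB HE.
(* The trivial coset leaves the first factor alone and contributes the product of the two
   supertraces. *)
rewrite sumrB; congr (_ - _).
  rewrite mulr_suml; apply: eq_bigr => a _; rewrite mulr_sumr; apply: eq_bigr => u _.
  rewrite mulr_sumr; apply: eq_bigr => w _.
  by rewrite addbb andFb addbF -scalerAl -scalerAr !scalerA mulrC.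
rewrite -scaler_sumr.
have [->|npos] := posnP n; first by rewrite !scale0r.
rewrite {HE} /H /g -{H g}(prednK npos); move: n.-1 => {npos}n; congr (_ *: _).
rewrite /ext_trace_with.
rewrite (big_tuple_cons n (fun u => \sum_(w : n.+1.-tuple L) Y u w *: super_cons (mulX M) T w u)).
apply: eq_bigr => a _.
rewrite (big_tuple_cons n (fun u => if u is b :: z then eps a b *:
  \sum_(w : n.+1.-tuple L) Y (a :: z) w *: super_cons M T (b :: w) (a :: u) else 0)).
rewrite exchange_big /=.
apply: eq_bigr => z _.
rewrite (big_tuple_cons n (fun w => Y (a :: z) w *: super_cons (mulX M) T w (a :: z))).
under eq_bigr => b _ do
  rewrite (big_tuple_cons n (fun w => Y (a :: z) w *: ((-1) ^+ (pa a (+) ((pa b (+) pa a) && pw w)) *: (M b a * T w (b :: z))))) scaler_sumr.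
rewrite exchange_big /=; apply: eq_bigr => c _.
under eq_bigr => b _ do rewrite scaler_sumr.
rewrite exchange_big /=; apply: eq_bigr => w _.
rewrite /mulX mulr_suml !scaler_sumr; apply: eq_bigr => b _.
rewrite -!scalerAr !mulrA MC -!scalerAl !scalerA; congr (_ *: _).
rewrite /eps; move: (_^-1 * _) => y; rewrite (mulrC _ y) -!mulrA; congr (_ * _); rewrite -!signr_addb; congr (_ ^+ nat_of_bool _).
by case: (pa a); case: (pa b); case: (pa c); case: (pw w).
Qed.

(** The power X^{r+1} under the plain matrix product. *)
Definition powX r : L -> L -> B := iter r mulX x.

Lemma powX_supercommutes r : supercommutes (powX r).
Proof.
elim: r => //= r IH a b c e; rewrite /mulX mulr_suml mulr_sumr scaler_sumr.
apply: eq_bigr => f _; rewrite -mulrA IH -scalerAr mulrA xC -!scalerAl scalerA mulrA.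
congr (_ *: _); rewrite -signr_addb; congr (_ ^+ nat_of_bool _).
by case: (pa a); case: (pa b); case: (pa c); case: (pa e); case: (pa f).
Qed.

(** Iteration of [newton_step]; the exponent i is general because each step raises it by one. *)
Lemma newton_with n i : n.+1%:R *: ext_trace_with n.+1 (powX i)
  = \sum_(r < n.+1) (-1) ^+ r *: (supertrace (powX (i + r)) * ext_trace (n - r)).
Proof.
elim: n i => [|n IH] i; rewrite (newton_step _ (powX_supercommutes i)).
  by rewrite scale0r subr0 big_ord1 scale1r addn0.
rewrite big_ord_recl scale1r addn0 subn0; congr (_ + _).
rewrite (IH i.+1) -sumrN; apply: eq_bigr => r _.
by rewrite /= exprS mulN1r scaleNr addnS.
Qed.

Lemma newton n : n.+1%:R *: ext_trace n.+1
  = \sum_(r < n.+1) (-1) ^+ r *: (supertrace (powX r) * ext_trace (n - r)).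
Proof. by rewrite ext_traceS (newton_with n 0). Qed.

End SuperTrace.

(** * The product of the two characters *)

Section FunctionMatrices.
Variable I : finType.

Definition fmul (R : pzRingType) (A C : I -> I -> R) : I -> I -> R :=
  fun i j => \sum_l A i l * C l j.
Definition fone (R : pzRingType) : I -> I -> R := fun i j => (i == j)%:R.
Definition ftr (R : pzRingType) (A : I -> I -> R) : R := \sum_i A i i.
Definition fdiag (R : pzRingType) (D : pred I) : I -> I -> R := fun i j => ((i == j) && D i)%:R.

Lemma fmulE (R : pzRingType) (A C : I -> I -> R) i j : fmul A C i j = \sum_l A i l * C l j.
Proof. by []. Qed.

Lemma fmulA (R : pzRingType) (A C D : I -> I -> R) : fmul A (fmul C D) = fmul (fmul A C) D.
Proof.
apply/funext => i; apply/funext => j; rewrite !fmulE.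
under eq_bigr do rewrite fmulE mulr_sumr.
rewrite exchange_big; apply: eq_bigr => l _; rewrite fmulE mulr_suml.
by apply: eq_bigr => h _; rewrite mulrA.
Qed.

Lemma fmul1 (R : pzRingType) (A : I -> I -> R) : fmul A (fone R) = A.
Proof.
apply/funext => i; apply/funext => j; rewrite fmulE (bigD1 j) //= /fone eqxx mulr1.
by rewrite big1 ?addr0 // => l /negbTE ->; rewrite mulr0.
Qed.

Lemma f1mul (R : pzRingType) (A : I -> I -> R) : fmul (fone R) A = A.
Proof.
apply/funext => i; apply/funext => j; rewrite fmulE (bigD1 i) //= /fone eqxx mul1r.
by rewrite big1 ?addr0 // => l; rewrite eq_sym => /negbTE ->; rewrite mul0r.
Qed.

Lemma fdiag_mul (R : pzRingType) D (A : I -> I -> R) i j :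
  fmul (fdiag R D) A i j = if D i then A i j else 0.
Proof.
rewrite fmulE (bigD1 i) //= big1 ?addr0 /fdiag ?eqxx.
  by case: (D i); rewrite ?mul1r ?mul0r.
by move=> l; rewrite eq_sym => /negbTE ->; rewrite mul0r.
Qed.

Lemma mul_fdiag (R : pzRingType) D (A : I -> I -> R) i j :
  fmul A (fdiag R D) i j = if D j then A i j else 0.
Proof.
rewrite fmulE (bigD1 j) //= big1 ?addr0 /fdiag ?eqxx.
  by case: (D j); rewrite ?mulr1 ?mulr0.
by move=> l /negbTE ->; rewrite mulr0.
Qed.

Variables (k : fieldType) (B : algType k).

Definition femb (A : I -> I -> k) : I -> I -> B := fun i j => (A i j)%:A.

Lemma femb_mul A C : femb (fmul A C) = fmul (femb A) (femb C).
Proof.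
apply/funext => i; apply/funext => j; rewrite /femb !fmulE scaler_suml.
by apply: eq_bigr => l _; rewrite mulr_algl scalerA.
Qed.

Lemma femb_one : femb (fone k) = fone B.
Proof.
apply/funext => i; apply/funext => j; rewrite /femb /fone.
by case: eqP; rewrite ?scale1r ?scale0r.
Qed.

(** [B] is not commutative: cyclicity rests on the entries of A being scalars. *)
Lemma ftr_embC A (M : I -> I -> B) : ftr (fmul (femb A) M) = ftr (fmul M (femb A)).
Proof.
rewrite /ftr; under eq_bigr do rewrite fmulE.
under [RHS]eq_bigr do rewrite fmulE.
rewrite exchange_big; apply: eq_bigr => l _; apply: eq_bigr => i _.
by rewrite mulr_algl mulr_algr.
Qed.

(* Z is a projection with the same kernel as fdiag D, Y one with the same image as
   fdiag E, and M preserves both subspaces: only the diagonal of M is left. *)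
Lemma ftr_compress (D E : pred I) (Z Y : I -> I -> k) (M : I -> I -> B) :
  fmul Z Y = fmul Y Z ->
  (forall u w, D u -> Z u w = (u == w)%:R) -> (forall u w, ~~ D w -> Z u w = 0) ->
  (forall u w, E w -> Y u w = (u == w)%:R) -> (forall u w, ~~ E u -> Y u w = 0) ->
  (forall u w, D u -> ~~ D w -> M u w = 0) ->
  (forall u w, E w -> ~~ E u -> M u w = 0) ->
  ftr (fmul (femb (fmul Z Y)) M) = \sum_(w | D w && E w) M w w.
Proof.
move=> ZY z1 z2 y1 y2 m1 m2.
pose dD := fdiag B D; pose dE := fdiag B E.
have DZ : fmul dD (femb Z) = dD.
  apply/funext => i; apply/funext => j; rewrite fdiag_mul /dD /fdiag /femb.
  by case Di: (D i); rewrite ?andbF // z1 // andbT; case: eqP; rewrite ?scale1r ?scale0r.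
have ZD : fmul (femb Z) dD = femb Z.
  apply/funext => i; apply/funext => j; rewrite mul_fdiag /femb.
  by case Dj: (D j) => //; rewrite z2 ?Dj ?scale0r.
have EY : fmul dE (femb Y) = femb Y.
  apply/funext => i; apply/funext => j; rewrite fdiag_mul /femb.
  by case Ei: (E i) => //; rewrite y2 ?Ei ?scale0r.
have YE : fmul (femb Y) dE = dE.
  apply/funext => i; apply/funext => j; rewrite mul_fdiag /dE /fdiag /femb.
  case Ej: (E j); first by rewrite y1 //; case: eqP => [->|]; rewrite ?Ej ?scale1r ?scale0r.
  by case: eqP => // ->; rewrite Ej.
have MD : fmul (fmul dD M) dD = fmul dD M.
  apply/funext => i; apply/funext => j; rewrite mul_fdiag fdiag_mul.
  by case Dj: (D j) => //; case Di: (D i) => //; rewrite m1 ?Dj.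
have ME : fmul dE (fmul M dE) = fmul M dE.
  apply/funext => i; apply/funext => j; rewrite fdiag_mul mul_fdiag.
  by case Ei: (E i) => //; case Ej: (E j) => //; rewrite m2 ?Ei.
have DE : fmul dD dE = fmul dE dD.
  apply/funext => i; apply/funext => j; rewrite fdiag_mul mul_fdiag /dE /dD /fdiag.
  by case: eqP => [->|] //=; case: (D i); case: (D j).
(* With D and E standing for the diagonal projections [dD] and [dE]: tr(ZYM) = tr(YZDM) = tr(DMDZY)
   = tr(DMY) = tr(YDME) = tr(EDME). Invariance enters as DMD = DM and EME = ME. *)
have e1 : femb (fmul Z Y) = fmul (femb (fmul Y Z)) dD.
  by rewrite ZY femb_mul -fmulA ZD.
rewrite e1 -fmulA -MD ftr_embC -ZY femb_mul -[fmul _ (fmul _ (femb Y))]fmulA.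
rewrite [fmul dD (fmul (femb Z) _)]fmulA DZ fmulA MD.
rewrite -EY fmulA -ftr_embC -(fmulA dD) -ME [fmul dD (fmul dE _)]fmulA DE.
rewrite -[fmul (fmul dE dD) _]fmulA (fmulA (femb Y)) YE.
rewrite -[LHS]/(\sum_i _) [RHS]big_mkcond; apply: eq_bigr => i _.
rewrite !fdiag_mul mul_fdiag.
by case: (D i); case: (E i).
Qed.

End FunctionMatrices.

(** * Normal forms modulo the relations, and F_l E_m as a diagonal sum *)

Section Factorization.
Variables (d : nat) (pa : 'I_d -> bool) (k : fieldType).
Hypothesis char0 : [pchar k] =i pred0.
Variable N : nat.
Local Notation L := 'I_d.
Local Notation asc := (asc pa).
Local Notation eps := (eps pa k).
Local Notation asym := (asym pa).
Local Notation Y := (antisymmetrizer pa k).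
Local Notation pw := (parity_word pa).

Definition asc_block (w : seq L) (st : nat) : bool :=
  all (fun r => asc w (st + r)) (iota 0 N.-1).

Definition good_word (w : seq L) : bool :=
  all (fun st => ~~ asc_block w st) (iota 0 ((size w).+1 - N)).

Definition asc_tail (l : nat) (w : seq L) : bool :=
  all (asc w) (iota l ((size w).-1 - l)).

Lemma good_wordP w : reflect
  (forall st, (st + N <= size w)%N -> exists2 r, (r.+1 < N)%N & ~~ asc w (st + r))
  (good_word w).
Proof.
apply: (iffP allP) => [h st stN|h st].
  have /h : st \in iota 0 ((size w).+1 - N) by rewrite mem_iota; lia.
  by case/allPn => r; rewrite mem_iota => rN nas; exists r => //; lia.
rewrite mem_iota => st_lt; have [|r rN nas] := h st; first by lia.
by apply/allPn; exists r => //; rewrite mem_iota; lia.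
Qed.

Lemma asc_tailP l w : reflect
  (forall j, (l <= j)%N -> (j.+1 < size w)%N -> asc w j) (asc_tail l w).
Proof.
apply: (iffP allP) => [h j lj jn|h j]; first by apply: h; rewrite mem_iota; lia.
by rewrite mem_iota => jl; apply: h; lia.
Qed.

(** Sums of such tensors are the relations of S_N(V) in degree l. *)
Definition block_asym (l : nat) (v : seq L -> k^o) : Prop :=
  exists2 st, (st + N <= l)%N & forall r, (r.+1 < N)%N -> asym l (st + r) v.

(** A good word misses an ascent in every block of N letters, in particular in the one where v is
    antisymmetric. *)
Lemma block_asym_coord l (be ga : seq L -> seq L -> k) (v : seq L -> k^o) (u : l.-tuple L) :
  adapted_basis pa l be ga -> block_asym l v -> good_word u ->
  \sum_(t : l.-tuple L) ga u t * (v t : k) = 0.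
Proof.
move=> ab [st stl vas] /good_wordP /(_ st); rewrite size_tuple => /(_ stl) [r rN nas].
by apply: (adapted_coord ab (vas r rN)) nas; lia.
Qed.

(** This is the independence of the words of Lambda modulo the relations. Going up the lexicographic
    order, the component along b_w vanishes by hypothesis if w is good, and by [v w = 0] and
    unitriangularity of [be] if w is bad. *)
Lemma good_support_eq0 l (be ga : seq L -> seq L -> k) (v : seq L -> k) :
  adapted_basis pa l be ga ->
  (forall u : l.-tuple L, good_word u -> \sum_(t : l.-tuple L) ga u t * v t = 0) ->
  (forall u : l.-tuple L, ~~ good_word u -> v u = 0) ->
  forall u : l.-tuple L, v u = 0.
Proof.
move=> ab coord0 supp.
pose c (w : l.-tuple L) := \sum_(t : l.-tuple L) ga w t * v t.
have vE (u : l.-tuple L) : v u = \sum_(w : l.-tuple L) be u w * c w.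
  under eq_bigr do rewrite mulr_sumr.
  rewrite exchange_big /= (bigD1 u) //= [X in _ = _ + X]big1 ?addr0.
    under eq_bigr do rewrite mulrA.
    by rewrite -mulr_suml (adapted_mulr ab) eqxx mul1r.
  move=> t tu; under eq_bigr do rewrite mulrA.
  by rewrite -mulr_suml (adapted_mulr ab) eq_sym (negbTE tu) mul0r.
suff c0 w : c w = 0 by move=> u; rewrite vE big1 // => w _; rewrite c0 mulr0.
have [m] := ubnP (valn w); elim: m w => // m IH w; rewrite ltnS => lm.
case gw: (good_word w); first exact: coord0.
have := supp w; rewrite gw => /(_ isT); rewrite vE (bigD1 w) //= (adapted_diag ab) ?size_tuple //.
rewrite mul1r big1 ?addr0 // => t tw.
have [->|bn0] := eqVneq (be w t) 0; first by rewrite mul0r.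
case: (adapted_low ab (size_tuple w) (size_tuple t) bn0) => [/val_inj e|lt].
  by rewrite e eqxx in tw.
by rewrite IH ?mulr0 // (leq_trans lt).
Qed.

(** Column w of P is a normal form of x_w, congruent to it modulo the relations. *)
Definition reduction (l : nat) (P : seq L -> seq L -> k) : Prop :=
  (forall u w : l.-tuple L, ~~ good_word u -> P u w = 0) /\
  (forall w : l.-tuple L, exists (J : finType) (c : J -> seq L -> k^o),
     (forall j, block_asym l (c j)) /\
     (forall u : l.-tuple L, (u == w)%:R - P u w = \sum_j c j u)).

Section Reduction.
Variables (l : nat) (P : seq L -> seq L -> k).
Hypothesis redP : reduction l P.

(** Both v and v - P v are relations, hence so is P v; being supported on good words, it
    vanishes. *)
Lemma reduction_kill (v : seq L -> k^o) (u : l.-tuple L) :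
  block_asym l v -> \sum_(w : l.-tuple L) P u w * (v w : k) = 0.
Proof.
move=> bv; have [be [ga ab]] := adapted_basis_exists pa char0 l.
apply: (good_support_eq0 (v := fun u => \sum_(w : l.-tuple L) P u w * v w) ab) => {}u gu;
  last by rewrite big1 // => w _; rewrite redP.1 ?mul0r.
have E (t : l.-tuple L) : \sum_(w : l.-tuple L) P t w * v w
    = v t - \sum_(w : l.-tuple L) ((t == w)%:R - P t w) * v w.
  under [X in _ - X]eq_bigr do rewrite mulrBl.
  rewrite sumrB [X in _ - (X - _)](bigD1 t) //= eqxx mul1r [X in _ - (_ + X - _)]big1 ?addr0.
    by rewrite opprB addrC subrK.
  by move=> w /negbTE; rewrite eq_sym => ->; rewrite mul0r.
under eq_bigr do rewrite E mulrBr.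
rewrite sumrB (block_asym_coord ab bv gu) sub0r.
apply/eqP; rewrite oppr_eq0; apply/eqP.
under eq_bigr do rewrite mulr_sumr.
rewrite exchange_big big1 //= => w _.
have [J [c [cb cE]]] := redP.2 w.
under eq_bigr do rewrite cE mulrA mulr_sumr.
rewrite -mulr_suml exchange_big big1 ?mul0r //= => j _.
exact: (block_asym_coord ab (cb j) gu).
Qed.

(** Relations split into relations of pure parity. So the part of column w of the wrong parity is a
    relation supported on good words, hence zero. *)
Lemma reduction_parity (u w : l.-tuple L) : P u w != 0 -> pw u = pw w.
Proof.
move=> Pn0; apply/eqP; apply: contraNT Pn0 => neq; apply/eqP.
have [be [ga ab]] := adapted_basis_exists pa char0 l.
pose v t : k := if pw t == pw w then 0 else P t w.
suff: v u = 0 by rewrite /v (negbTE neq).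
apply: (good_support_eq0 (v := v) ab) => {neq}u gu; last first.
  by rewrite /v; case: ifP => // _; rewrite redP.1.
have [J [c [cb cE]]] := redP.2 w.
pose c' j t : k^o := if pw t == pw w then 0 else c j t.
have vE (t : l.-tuple L) : v t = - \sum_j c' j t.
  rewrite /v /c'; case: ifP => e; first by rewrite big1 ?oppr0.
  rewrite -cE; case: eqP => [et|_]; first by rewrite et eqxx in e.
  by rewrite sub0r opprK.
under eq_bigr do rewrite vE mulrN mulr_sumr.
rewrite sumrN exchange_big big1 ?oppr0 //= => j _; apply: (block_asym_coord ab _ gu).
have [st stl cas] := cb j; exists st => // r rN s1 a b s2 szs szn.
rewrite /c' (cas r rN) // !parity_word_cat /= [pa b (+) (_ (+) _)]addbCA.
by case: ifP => // _; rewrite scaler0 oppr0.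
Qed.

End Reduction.

Lemma asym_catr (V : lmodType k) l m j (v : seq L -> V) (t : seq L) :
  size t = m -> asym (l + m) j v -> asym l j (fun s => v (s ++ t)).
Proof.
move=> szt vas s1 a b s2 szs szn; rewrite -!catA /=; apply: vas => //.
by rewrite size_cat szt; lia.
Qed.

Lemma asym_catl (V : lmodType k) l m j (v : seq L -> V) (s : seq L) :
  size s = l -> asym (l + m) (l + j) v -> asym m j (fun t => v (s ++ t)).
Proof.
move=> szs vas s1 a b s2 sz1 szn; rewrite !catA; apply: vas; rewrite size_cat szs; lia.
Qed.

Variables (B : algType k) (x : L -> L -> B).
Hypothesis xC : supercommutes pa x x.
Local Notation T := (coaction pa x).

Definition adapted_coaction n (be ga : seq L -> seq L -> k) : n.-tuple L -> n.-tuple L -> B :=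
  fmul (fmul (femb B (fun u w : n.-tuple L => ga u w)) (fun u w : n.-tuple L => T u w))
       (femb B (fun u w : n.-tuple L => be u w)).

(** The image of b_w under the coaction is still antisymmetric at j, so it has no component along
    b_u. *)
Lemma adapted_coaction_triangular n be ga (u w : n.-tuple L) j :
  adapted_basis pa n be ga -> (j.+1 < n)%N -> asc w j -> ~~ asc u j ->
  adapted_coaction be ga u w = 0.
Proof.
move=> ab jn ascw nascu; rewrite /adapted_coaction -fmulA fmulE.
have A := equivariant_suml (@coaction_equivariant _ pa _ _ _ xC n j)
  (adapted_asym ab (size_tuple w) ascw).
rewrite -[RHS](adapted_coord ab A jn nascu); apply: eq_bigr => t _.
rewrite mulr_algl; congr (_ *: _); rewrite fmulE; apply: eq_bigr => s _.
by rewrite mulr_algr.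
Qed.

(** The product is the trace of the coaction against Z Y', where Z applies P to the first l letters
    and Y' antisymmetrizes the last m. In the adapted basis the kernel of Z and the image of Y' are
    coordinate subspaces preserved by the coaction, which is the situation of [ftr_compress]. *)
Lemma reduction_ext_trace l m be ga (P : seq L -> seq L -> k) :
  reduction l P -> adapted_basis pa (l + m) be ga ->
  (\sum_(u : l.-tuple L) \sum_(w : l.-tuple L) P u w *: T w u) * ext_trace pa x m
  = \sum_(w : (l + m).-tuple L | good_word (take l w) && asc_tail l w)
      adapted_coaction be ga w w.
Proof.
move=> redP ab; pose n := (l + m)%N.
pose Z (u w : n.-tuple L) := P (take l u) (take l w) * (drop l u == drop l w)%:R.
pose Y' (u w : n.-tuple L) := (take l u == take l w)%:R * Y (drop l u) (drop l w).
pose Be (u w : n.-tuple L) := be u w.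
pose Ga (u w : n.-tuple L) := ga u w.
have take_tuple (u : n.-tuple L) : exists2 u1 : l.-tuple L, take l u = u1 &
    exists2 u2 : m.-tuple L, drop l u = u2 & tval u = u1 ++ u2.
  have sz1 : size (take l u) == l by rewrite size_takel // size_tuple leq_addr.
  have sz2 : size (drop l u) == m by rewrite size_drop size_tuple addKn.
  by exists (Tuple sz1) => //; exists (Tuple sz2) => //=; rewrite cat_take_drop.
have sumcat (f : seq L -> k) : \sum_(t : n.-tuple L) f t
    = \sum_(s : l.-tuple L) \sum_(t : m.-tuple L) f (s ++ t) by apply: big_tuple_cat.
have tk (s : l.-tuple L) (t : seq L) : take l (s ++ t) = s.
  by rewrite take_size_cat ?size_tuple.
have dr (s : l.-tuple L) (t : seq L) : drop l (s ++ t) = t.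
  by rewrite drop_size_cat ?size_tuple.
have ZYE u w : fmul Z Y' u w = P (take l u) (take l w) * Y (drop l u) (drop l w).
  have [u1 eu1 [u2 eu2 _]] := take_tuple u; have [w1 ew1 [w2 ew2 _]] := take_tuple w.
  rewrite fmulE (sumcat (fun t => P (take l u) (take l t) * (drop l u == drop l t)%:R *
    ((take l t == take l w)%:R * Y (drop l t) (drop l w)))).
  rewrite eu1 eu2 ew1 ew2 (bigD1 w1) //= [X in _ + X]big1 ?addr0; last first.
    move=> s sw; rewrite big1 // => t _; rewrite tk val_eqE (negbTE sw) mul0r mulr0 //.
  rewrite (bigD1 u2) //= [X in _ + X]big1 ?addr0; last first.
    by move=> t tu; rewrite dr val_eqE eq_sym (negbTE tu) mulr0 mul0r.
  by rewrite tk dr !eqxx mulr1 mul1r.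
have ZY : fmul Z Y' = fmul Y' Z.
  apply/funext => u; apply/funext => w; rewrite ZYE.
  have [u1 eu1 [u2 eu2 _]] := take_tuple u; have [w1 ew1 [w2 ew2 _]] := take_tuple w.
  rewrite fmulE (sumcat (fun t => (take l u == take l t)%:R * Y (drop l u) (drop l t) *
    (P (take l t) (take l w) * (drop l t == drop l w)%:R))).
  rewrite eu1 eu2 ew1 ew2 (bigD1 u1) //= [X in _ + X]big1 ?addr0; last first.
    by move=> s su; rewrite big1 // => t _; rewrite tk val_eqE eq_sym (negbTE su) !mul0r.
  rewrite (bigD1 w2) //= [X in _ + X]big1 ?addr0; last first.
    by move=> t tw; rewrite dr val_eqE (negbTE tw) !mulr0.
  by rewrite tk dr !eqxx mulr1 mul1r mulrC.
have BG : fmul Be Ga = fone k.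
  by apply/funext => u; apply/funext => w; rewrite fmulE (adapted_mulr ab).
have GB : fmul Ga Be = fone k.
  by apply/funext => u; apply/funext => w; rewrite fmulE (adapted_mull ab).
have lhs : (\sum_(u : l.-tuple L) \sum_(w : l.-tuple L) P u w *: T w u) * ext_trace pa x m
    = ftr (fmul (femb B (fmul Z Y')) (fun u w : n.-tuple L => T u w)).
  rewrite /ftr.
  under [RHS]eq_bigr do rewrite fmulE.
  under [RHS]eq_bigr do under eq_bigr do rewrite /femb ZYE mulr_algl.
  rewrite (big_tuple_cat l m (fun u => \sum_(w : n.-tuple L)
     (P (take l u) (take l w) * Y (drop l u) (drop l w)) *: T w u)) mulr_suml.
  apply: eq_bigr => u1 _; rewrite mulr_sumr; apply: eq_bigr => u2 _.
  rewrite (big_tuple_cat l m (fun w => (P (take l (u1 ++ u2)) (take l w) *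
    Y (drop l (u1 ++ u2)) (drop l w)) *: T w (u1 ++ u2))) mulr_suml.
  apply: eq_bigr => w1 _; rewrite mulr_sumr; apply: eq_bigr => w2 _.
  (* The Koszul sign between the two factors is trivial because P preserves parity. *)
  rewrite !tk !dr coaction_cat ?size_tuple // -scalerAl -scalerAr !scalerA.
  have [->|Pn0] := eqVneq (P u1 w1) 0; first by rewrite !mul0r !scale0r.
  by rewrite (reduction_parity redP Pn0) addbb andFb expr0 mulr1.
rewrite {}lhs.
have {}ZY : fmul (fmul (fmul Ga Z) Be) (fmul (fmul Ga Y') Be)
    = fmul (fmul (fmul Ga Y') Be) (fmul (fmul Ga Z) Be).
  rewrite -!fmulA [fmul Be (fmul Ga (fmul Y' _))]fmulA [fmul Be (fmul Ga (fmul Z _))]fmulA BG.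
  by rewrite !f1mul [fmul Z (fmul Y' _)]fmulA ZY -!fmulA.
pose T' := adapted_coaction (n := n) be ga.
have -> : ftr (fmul (femb B (fmul Z Y')) (fun u w : n.-tuple L => T u w))
    = ftr (fmul (femb B (fmul (fmul (fmul Ga Z) Be) (fmul (fmul Ga Y') Be))) T').
  rewrite /T' /adapted_coaction -/Ga -/Be !femb_mul.
  have BGB : fmul (femb B Be) (femb B Ga) = fone B by rewrite -femb_mul BG femb_one.
  rewrite -!fmulA [fmul (femb B Be) (fmul (femb B Ga) (fmul (femb B Y') _))]fmulA BGB f1mul.
  rewrite [fmul (femb B Be) (fmul (femb B Ga) (fmul _ (femb B Be)))]fmulA BGB f1mul.
  by rewrite [RHS]ftr_embC -!fmulA BGB fmul1.
rewrite (ftr_compress (D := fun u : n.-tuple L => good_word (take l u))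
  (E := fun u : n.-tuple L => asc_tail l u)) //.
(* Z is the identity modulo relations among the first l letters, and these have no component along
   b_u. *)
- move=> u w gu; rewrite -[RHS]/(fone k u w) -GB !fmulE; apply: eq_bigr => s _.
  congr (_ * _); rewrite fmulE.
  have [s1 es1 [s2 es2 es]] := take_tuple s.
  have [J [c [cb cE]]] := redP.2 s1.
  have ZE (t : n.-tuple L) : Z t s
      = (t == s)%:R - \sum_j c j (take l t) * (drop l t == s2 :> seq L)%:R.
    have [t1 et1 [t2 et2 et]] := take_tuple t.
    have -> : (t == s) = (t1 == s1) && (val t2 == val s2).
      by rewrite -(inj_eq val_inj) /= et es eqseq_cat ?size_tuple.
    rewrite /Z et1 et2 es1 es2 -mulr_suml -cE mulrBl -natrM mulnb.
    by rewrite opprB addrC subrK.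
  under eq_bigr do rewrite ZE mulrBr mulr_sumr.
  rewrite sumrB (bigD1 s) //= eqxx mulr1 big1 ?addr0; last first.
    by move=> t /negbTE ->; rewrite mulr0.
  rewrite exchange_big big1 ?subr0 //= => j _.
  have [st stl cas] := cb j.
  have [u1 eu1 _] := take_tuple u.
  move: gu; rewrite eu1 => /good_wordP /(_ st); rewrite size_tuple => /(_ stl) [r rN nas].
  have rl : ((st + r).+1 < l)%N by lia.
  have := asym_prodl (fun y => (y == s2 :> seq L)%:R : k^o) (cas r rN) rl (leq_addr m l).
  move/(adapted_coord ab (w := u)); apply; first by rewrite ltn_addr.
  by rewrite -(cat_take_drop l u) eu1 asc_catl ?size_tuple.
(* An ascending block in the first l letters of w makes b_w a relation there, which P kills. *)
- move=> u w gw; rewrite -fmulA fmulE big1 // => t _.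
  suff -> : fmul Z Be t w = 0 by rewrite mulr0.
  have [t1 et1 [t2 et2 _]] := take_tuple t.
  rewrite fmulE (sumcat (fun s => P (take l t) (take l s) * (drop l t == drop l s)%:R * be s w)).
  rewrite exchange_big (bigD1 t2) //= [X in _ + X]big1 ?addr0; last first.
    move=> s2 st; rewrite big1 // => s1 _.
    by rewrite et2 dr val_eqE eq_sym (negbTE st) mulr0 mul0r.
  rewrite et1 et2; under eq_bigr do rewrite tk dr eqxx mulr1.
  apply: (reduction_kill redP (v := fun s => be (s ++ t2) w)).
  have [w1 ew1 _] := take_tuple w.
  move: gw; rewrite ew1 => /allPn [st]; rewrite mem_iota size_tuple negbK => st_lt /allP blk.
  exists st => [|r rN]; first by lia.
  apply: (@asym_catr k^o l m (st + r) (be^~ w) t2 (size_tuple t2)); apply: (adapted_asym ab); first exact: size_tuple.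
  rewrite -(cat_take_drop l w) ew1 asc_catl; last by rewrite size_tuple; lia.
  by apply: blk; rewrite mem_iota; lia.
- move=> u w tw; rewrite -[RHS]/(fone k u w) -GB -fmulA !fmulE; apply: eq_bigr => t _.
  congr (_ * _); have [t1 et1 [t2 et2 et]] := take_tuple t.
  rewrite fmulE (sumcat (fun s => (take l t == take l s)%:R * Y (drop l t) (drop l s) * be s w)).
  rewrite (bigD1 t1) //= [X in _ + X]big1 ?addr0; last first.
    by move=> s1 st; rewrite big1 // => s2 _; rewrite et1 tk val_eqE eq_sym (negbTE st) !mul0r.
  rewrite et1 et2; under eq_bigr do rewrite tk dr eqxx mul1r.
  rewrite /Be et; apply: (@antisymmetrizer_id _ _ _ char0 k^o m (fun s => be (t1 ++ s) w));
    last exact: size_tuple.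
  move=> j s1 a b s2 szs szn.
  apply: (@asym_catl k^o l m j (be^~ w)) => //; first exact: size_tuple.
  apply: (adapted_asym ab); first exact: size_tuple.
  by apply: (asc_tailP _ _ tw); rewrite ?leq_addr // size_tuple; lia.
(* The columns of Y' are antisymmetric in the last m letters, so they have no component along b_u
   when an ascent is missing there. *)
- move=> u w tu.
  have [j lj [jn nas]] : exists2 j, (l <= j)%N & (j.+1 < n)%N /\ ~~ asc u j.
    by case/allPn: tu => j; rewrite mem_iota size_tuple => jl nas; exists j; [|split=> //]; rewrite /n; lia.
  rewrite fmulE big1 // => s _.
  suff -> : fmul Ga Y' u s = 0 by rewrite mul0r.
  have [s1 es1 [s2 es2 _]] := take_tuple s.
  have := @asym_prodr _ pa k k^o l m (j - l) (fun y => (y == s1 :> seq L)%:R : k^o) _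
    (@antisymmetrizer_asyml _ pa k m s2 (j - l) (size_tuple s2)).
  rewrite subnKC // => /(adapted_coord ab (w := u)) /(_ jn nas) E.
  by rewrite fmulE -[RHS]E; apply: eq_bigr => t _; rewrite /Y' es1 es2.
(* Some block of w consists of ascents, and u misses one of them. *)
- move=> u w gu gw.
  have [u1 eu1 _] := take_tuple u; have [w1 ew1 _] := take_tuple w.
  move: gw; rewrite ew1 => /allPn [st]; rewrite mem_iota size_tuple negbK => st_lt /allP blk.
  move: gu; rewrite eu1 => /good_wordP /(_ st); rewrite size_tuple.
  case=> [|r rN nas]; first by lia.
  apply: (@adapted_coaction_triangular n be ga u w (st + r)) => //; first by rewrite /n; lia.
    rewrite -(cat_take_drop l w) ew1 asc_catl; last by rewrite size_tuple; lia.
    by apply: blk; rewrite mem_iota; lia.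
  by rewrite -(cat_take_drop l u) eu1 asc_catl // size_tuple; lia.
move=> u w tw /allPn [j]; rewrite mem_iota size_tuple => jl nas.
apply: (@adapted_coaction_triangular n be ga u w j) => //; first by rewrite /n; lia.
by apply: (asc_tailP _ _ tw); rewrite ?size_tuple; lia.
Qed.

End Factorization.

(** * Cancellation of the signs over the cuts of a word *)

Section Cancellation.
Variable N : nat.
Hypothesis N2 : (2 <= N)%N.
Variable R : pzRingType.

Definition koszul_sign (m : nat) : R :=
  if (m %% N == 0)%N || (m %% N == 1)%N then (-1) ^+ (m %% N)%N else 0.

(** Over one period the signs are 1, -1, 0, ..., 0. The partial sums thus have period N, and N
    consecutive signs add up to 0. *)
Lemma koszul_sign_psum a : \sum_(m < a) koszul_sign m = (a %% N == 1)%N%:R.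
Proof.
elim: a => [|a IH]; first by rewrite big_ord0 mod0n.
rewrite big_ord_recr IH /= /koszul_sign.
have lt : (a %% N < N)%N by rewrite ltn_mod; lia.
have -> : (a.+1 %% N = if (a %% N).+1 == N then 0 else (a %% N).+1)%N.
  rewrite -addn1 -modnDml addn1; case: eqP => [->|ne]; first by rewrite modnn.
  by rewrite modn_small //; lia.
move: (a %% N)%N lt => [|[|r]] lt /=; first by case: (eqVneq 1%N N) => [e|_]; [move: N2; rewrite -e|rewrite /= add0r expr0].
  by case: (eqVneq 2%N N) => _; rewrite expr1 subrr.
by rewrite addr0; case: (_ == N).
Qed.

Variables (d : nat) (pa : 'I_d -> bool).
Local Notation L := 'I_d.
Local Notation asc := (asc pa).
Local Notation good_word := (good_word pa N).
Local Notation asc_tail := (asc_tail pa).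

Lemma asc_take l (w : seq L) j : (j.+1 < l)%N -> (l <= size w)%N ->
  asc (take l w) j = asc w j.
Proof.
by move=> jl lw; rewrite -[in RHS](cat_take_drop l w) asc_catl // size_takel.
Qed.

(* The surviving cuts of w form a window of N consecutive positions starting where its
   last ascending run starts, truncated at the end of w. *)
Lemma good_asc_tailE (w : seq L) : (0 < size w)%N ->
  exists2 l0, (l0 < size w)%N & forall l, (l <= size w)%N ->
    good_word (take l w) && asc_tail l w
      = [&& good_word (take l0 w), (l0 <= l)%N & (l < l0 + N)%N].
Proof.
move=> wpos; pose n := size w.
have ex : exists l, asc_tail l w by exists n; apply/asc_tailP => j; lia.
case: (ex_minnP ex) => l0 tail0 min0.
have l0n : (l0 < n)%N.
  suff : (l0 <= n.-1)%N by lia.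
  by apply: min0; apply/asc_tailP => j; lia.
have desc : (0 < l0)%N -> ~~ asc w l0.-1.
  move=> l0pos; have: ~~ asc_tail l0.-1 w by apply/negP => /min0; lia.
  case/allPn => j; rewrite mem_iota => jl nas.
  have [e|ne] := eqVneq j l0.-1; first by rewrite -e.
  by case/negP: nas; apply: (asc_tailP _ _ _ tail0); move: ne => /eqP; lia.
exists l0 => // l ln.
have -> : asc_tail l w = (l0 <= l)%N.
  apply/idP/idP => [/min0//|l0l]; apply/asc_tailP => j lj.
  by apply: (asc_tailP _ _ _ tail0); lia.
case l0l: (l0 <= l)%N; rewrite ?andbF ?andbT //=.
have szt h : (h <= n)%N -> size (take h w) = h by move=> hn; rewrite size_takel.
apply/good_wordP/andP; rewrite szt //.
  move=> g; split.
    apply/good_wordP => st; rewrite szt ?(ltnW l0n) // => stl.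
    have [|r rN] := g st; first by lia.
    by rewrite asc_take //; [exists r; rewrite // asc_take //; lia|lia].
  rewrite ltnNge; apply/negP => lN; have [r rN] := g l0 lN.
  rewrite asc_take //; last by lia.
  by rewrite (asc_tailP _ _ _ tail0) //; rewrite -/n; lia.
case=> /good_wordP g lN st stl; rewrite szt ?(ltnW l0n) // in g.
have [st0|st0] := leqP (st + N) l0.
  have [r rN] := g st st0; rewrite asc_take //; [|by lia|by lia].
  by exists r; rewrite // asc_take //; lia.
exists (l0.-1 - st)%N; first by lia.
have -> : (st + (l0.-1 - st))%N = l0.-1 by lia.
by rewrite asc_take //; [apply: desc|]; lia.
Qed.

Lemma koszul_sign_cancel (w : seq L) : (0 < size w)%N ->
  \sum_(l < (size w).+1) (good_word (take l w) && asc_tail l w)%:R * koszul_sign (size w - l) = 0.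
Proof.
move=> wpos; have [l0 l0n wE] := good_asc_tailE wpos.
set n := size w in wpos l0n wE *.
rewrite (eq_bigr (fun l : 'I_n.+1 => (good_word (take l0 w))%:R *
    ([&& l0 <= l & l < l0 + N]%N%:R * koszul_sign (n - l)))); last first.
  move=> l _; rewrite wE; last by rewrite -ltnS ltn_ord.
  by case: (good_word _); rewrite ?mul1r ?mul0r.
rewrite -mulr_sumr (reindex_inj rev_ord_inj) /=.
(* r is the length of the last run; after the reversal m = n - l the window is r + 1 - N <= m <=
   r. *)
set r := (n - l0)%N.
rewrite (eq_bigr (fun m : 'I_n.+1 => (if (m < r.+1)%N then koszul_sign m else 0)
   - (if (m < r.+1 - N)%N then koszul_sign m else 0))); last first.
  move=> m _; have mn := ltn_ord m; rewrite subSS.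
  have -> : (n - (n - m) = m)%N by lia.
  have -> : (l0 <= n - m)%N = (m < r.+1)%N by rewrite /r; lia.
  have -> : (n - m < l0 + N)%N = ~~ (m < r.+1 - N)%N by rewrite /r; lia.
  case: ltnP => h1; case: ltnP => h2 /=; rewrite ?mul1r ?mul0r ?subr0 ?subrr //.
  by lia.
rewrite sumrB -!big_mkcond /= -!(big_ord_widen _ koszul_sign) ?koszul_sign_psum; [|rewrite /r; lia..].
have [rN|rN] := leqP N r.+1.
  by rewrite -[in X in X - _](subnK rN) modnDr subrr mulr0.
(* The truncated window starts at m = 0; its sum vanishes because 1 < r + 1 < N, the last run being
   nonempty. *)
have -> : (r.+1 - N = 0)%N by lia.
by rewrite mod0n modn_small //; case: eqP => //; rewrite ?subrr ?mulr0 //; rewrite /r; lia.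
Qed.

End Cancellation.

(** * The product formula in each degree *)

Section Assembly.
Variables (d : nat) (pa : 'I_d -> bool) (k : fieldType).
Hypothesis char0 : [pchar k] =i pred0.
Variable N : nat.
Hypothesis N2 : (2 <= N)%N.
Local Notation L := 'I_d.
Variables (B : algType k) (x : L -> L -> B).
Hypothesis xC : supercommutes pa x x.
Variable P : nat -> seq L -> seq L -> k.
Hypothesis redP : forall l, reduction pa N l (P l).

Definition reduced_trace l : B :=
  \sum_(u : l.-tuple L) \sum_(w : l.-tuple L) P l u w *: coaction pa x w u.

Lemma reduced_trace_cut n l be ga : (l <= n)%N -> adapted_basis pa n be ga ->
  reduced_trace l * ext_trace pa x (n - l)
  = \sum_(w : n.-tuple L) (good_word pa N (take l w) && asc_tail pa l w)%:R
      * adapted_coaction pa x (n := n) be ga w w.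
Proof.
move=> ln; move: (n - l)%N (subnKC ln) => {ln} m e; subst n => ab.
rewrite (reduction_ext_trace char0 xC (redP l) ab) big_mkcond /=; apply: eq_bigr => w _.
by case: ifP; rewrite ?mul1r ?mul0r.
Qed.

(** One adapted basis for words of length n serves every cut l, so the sum over l can be carried out
    for each fixed word. *)
Lemma reduced_trace_ext_trace n :
  \sum_(l < n.+1) reduced_trace l * (koszul_sign N B (n - l) * ext_trace pa x (n - l))
  = (n == 0)%N%:R.
Proof.
have [be [ga ab]] := adapted_basis_exists pa char0 n.
have E (l : 'I_n.+1) : reduced_trace l * (koszul_sign N B (n - l) * ext_trace pa x (n - l))
   = \sum_(w : n.-tuple L) (good_word pa N (take l w) && asc_tail pa l w)%:R
       * koszul_sign N B (n - l) * adapted_coaction pa x (n := n) be ga w w.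
  have C y : y * koszul_sign N B (n - l) = koszul_sign N B (n - l) * y.
    rewrite /koszul_sign; case: ifP => _; last by rewrite mulr0 mul0r.
    exact: commr_sign.
  rewrite mulrA C -mulrA (reduced_trace_cut _ ab); last by rewrite -ltnS.
  rewrite mulr_sumr.
  by apply: eq_bigr => w _; rewrite mulrA C.
under eq_bigr do rewrite E.
rewrite exchange_big /=.
under eq_bigr do rewrite -mulr_suml.
case: n ab {E} => [|n] ab; last first.
  rewrite big1 // => w _; have := koszul_sign_cancel N2 B pa (w := w).
  by rewrite size_tuple => ->; rewrite ?mul0r.
rewrite (eq_bigr (fun=> 1)) => [|w _]; first by rewrite sumr_const card_tuple expn0.
rewrite big_ord1 subnn (tuple0 w) /= /good_word /asc_tail /=.
have -> : (1 - N = 0)%N by lia.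
rewrite mul1r /koszul_sign mod0n expr0 mul1r /adapted_coaction.
have -> : (fun u w : 0.-tuple L => coaction pa x u w) = fone B.
  by apply/funext => u; apply/funext => v; rewrite (tuple0 u) (tuple0 v) /fone eqxx.
rewrite fmul1 -femb_mul (_ : fmul _ _ = fone k) ?femb_one; first by rewrite /fone eqxx.
by apply/funext => u; apply/funext => v; rewrite fmulE (adapted_mull ab).
Qed.

End Assembly.

(** * From words as finite functions to words as sequences *)

Section PermutationSigns.
Variables (N : nat) (g : 'I_N -> nat).

Definition weighted_inv (s : 'S_N) : nat :=
  (\sum_(a : 'I_N) \sum_(b : 'I_N | (a < b)%N && (s b < s a)%N) g a * g b)%N.

Lemma weighted_inv_step (s : 'S_N) (o0 o1 : 'I_N) : o1 = o0.+1 :> nat ->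
  ((s^-1)%g o0 < (s^-1)%g o1)%N ->
  weighted_inv (s * tperm o0 o1)%g
    = (weighted_inv s + g ((s^-1)%g o0) * g ((s^-1)%g o1))%N.
Proof.
move=> e10 lt; rewrite /weighted_inv !pair_big_dep /=.
set a0 := (s^-1)%g o0 in lt *; set b0 := (s^-1)%g o1 in lt *.
have sa0 : s a0 = o0 by rewrite permKV.
have sb0 : s b0 = o1 by rewrite permKV.
rewrite (bigD1 (a0, b0)) /=; last first.
  by rewrite !permM sa0 sb0 tpermL tpermR lt; lia.
rewrite addnC; congr (_ + _)%N; apply: eq_bigl => -[a b] /=.
rewrite !permM -pair_eqE /= /pair_eq /=.
have ea y : (y == a0) = (s y == o0) by rewrite -sa0 (inj_eq perm_inj).
have eb y : (y == b0) = (s y == o1) by rewrite -sb0 (inj_eq perm_inj).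
case ab: (a < b)%N => //=.
have h1 : s b = o0 -> s a = o1 -> False.
  by move=> /eqP + /eqP; rewrite -ea -eb => /eqP eb' /eqP ea'; move: ab; rewrite eb' ea'; lia.
rewrite ea eb.
have neq : s a != s b by rewrite (inj_eq perm_inj) -(inj_eq val_inj) /=; lia.
have tv (y : 'I_N) : tperm o0 o1 y = (if y == o0 :> nat then val o1
    else if y == o1 :> nat then val o0 else val y) :> nat.
  case: tpermP => [->|->|/eqP h0 /eqP h0']; rewrite ?eqxx //.
    by rewrite (_ : (o1 == o0 :> nat) = false) //; lia.
  by move: h0 h0'; rewrite -!(inj_eq val_inj) /= => /negbTE -> /negbTE ->.
have h2 : val (s b) = o0 -> val (s a) = o1 -> False.
  by move=> /val_inj hb /val_inj; apply: h1.
rewrite !tv -!(inj_eq val_inj) /=; move: neq h2; rewrite -(inj_eq val_inj) /=.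
move: (val (s a)) (val (s b)) (val o0) (val o1) e10 => A B p0 p1 -> ne h2.
by do !case: eqP => ? /=; lia.
Qed.

(** When the two values occur in the opposite order, the preceding step applies to the product with
    the transposition. *)
Lemma weighted_inv_sign (R : pzRingType) (s : 'S_N) (o0 o1 : 'I_N) : o1 = o0.+1 :> nat ->
  (-1) ^+ weighted_inv (s * tperm o0 o1)%g
    = (-1) ^+ weighted_inv s * (-1) ^+ (g ((s^-1)%g o0) * g ((s^-1)%g o1))%N :> R.
Proof.
move=> e10; case: (ltngtP ((s^-1)%g o0) ((s^-1)%g o1)) => [lt|gt|e].
- by rewrite weighted_inv_step // exprD.
- have := @weighted_inv_step (s * tperm o0 o1)%g o0 o1 e10.
  rewrite !invMg !permM tpermV tpermL tpermR -mulgA tperm2 mulg1 => /(_ gt) ->.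
  by rewrite exprD -mulrA -exprD mulnC addnn -mul2n exprM sqrrN !expr1n mulr1.
by move/val_inj/perm_inj: e => e; move: e10; rewrite e; lia.
Qed.

End PermutationSigns.

(** * Relations, Lambda and the coaction in terms of sequences *)

Section Bridge.
Variables (k : fieldType) (N p q : nat).
Hypothesis N2 : (2 <= N)%N.
Local Notation L := 'I_(p + q).
Local Notation word l := {ffun 'I_l -> L}.

Definition odd_letter (a : L) : bool := (p <= a)%N.
Local Notation pa := odd_letter.

Lemma wnthE l (w : word l) (i : 'I_l) : wnth w i = w i.
Proof. by rewrite /wnth valK. Qed.

Lemma wnth_default l (w : word l) j : (l <= j)%N -> wnth w j = 0%N.
Proof. by move=> lj; rewrite /wnth insubF // ltnNge lj. Qed.

Section PermBlock.
Variables (l st : nat) (stl : (st + N <= l)%N).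

Fact block_pos_proof (o : 'I_N) : (st + o < l)%N.
Proof. by have := ltn_ord o; lia. Qed.
Definition block_pos (o : 'I_N) : 'I_l := Ordinal (block_pos_proof o).

Lemma perm_block_pos (s : 'S_N) (w : word l) (o : 'I_N) :
  perm_block st s w (block_pos o) = w (block_pos ((s^-1)%g o)).
Proof.
rewrite ffunE /= leq_addr /permn addKn valK /=; congr (w _); apply: val_inj.
by rewrite /= insubdK //; apply: block_pos_proof.
Qed.

Lemma perm_block_out (s : 'S_N) (w : word l) (i : 'I_l) :
  (forall o, i != block_pos o) -> perm_block st s w i = w i.
Proof.
move=> out; rewrite ffunE; case: leqP => // sti.
have iN : (N <= i - st)%N.
  rewrite leqNgt; apply/negP => h; have := out (Ordinal h).
  by rewrite -(inj_eq val_inj) /= subnKC // eqxx.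
rewrite /permn insubF; last by rewrite ltnNge iN.
by rewrite /= subnKC //; congr (w _); apply: val_inj; rewrite insubdK //; apply: ltn_ord.
Qed.

Lemma perm_block_swap (s : 'S_N) (w : word l) (o0 o1 : 'I_N) :
  perm_block st (s * tperm o0 o1)%g w
  = [ffun i => perm_block st s w (tperm (block_pos o0) (block_pos o1) i)].
Proof.
have inj : injective block_pos by move=> o o' [/addnI/val_inj].
apply/ffunP => i; rewrite [RHS]ffunE.
case: (pickP (fun o => i == block_pos o)) => [o /eqP ->|out].
  have -> : tperm (block_pos o0) (block_pos o1) (block_pos o) = block_pos (tperm o0 o1 o).
    case: (tpermP o0 o1 o) => [->|->|/eqP h0 /eqP h1]; rewrite ?tpermL ?tpermR //.
    by rewrite tpermD // eq_sym inj_eq.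
  by rewrite !perm_block_pos invMg tpermV permM.
have h o : i != block_pos o by rewrite out.
by rewrite tpermD ?perm_block_out // eq_sym h.
Qed.

(** Reindexing the sum over S_N by right multiplication with the transposition flips the signature
    and changes the Koszul sign by the parities of the two exchanged letters. *)
Lemma gen_swap (w u : word l) (o0 o1 : 'I_N) : o1 = o0.+1 :> nat ->
  gen k N w st [ffun i => u (tperm (block_pos o0) (block_pos o1) i)]
  = - ((-1) ^+ (pa (u (block_pos o0)) && pa (u (block_pos o1))) * gen k N w st u).
Proof.
move=> e10; rewrite /gen mulrCA -mulrN; congr (_ * _).
rewrite (reindex_inj (mulIg (tperm o0 o1))) /= mulr_sumr -sumrN; apply: eq_bigr => s _.
rewrite perm_block_swap.
have -> : ([ffun i => perm_block st s w (tperm (block_pos o0) (block_pos o1) i)]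
   == [ffun i => u (tperm (block_pos o0) (block_pos o1) i)]) = (perm_block st s w == u).
  apply/eqP/eqP => [/ffunP e|->//]; apply/ffunP => i.
  by have := e (tperm (block_pos o0) (block_pos o1) i); rewrite !ffunE tpermK.
case: eqP => [<-|]; last by rewrite !mulr0 oppr0.
have invE (t : 'S_N) : inv_sign st t w
    = weighted_inv (fun o => parn p (wnth w (st + o))) t by [].
rewrite !invE weighted_inv_sign // odd_permM odd_tperm signr_addb !perm_block_pos.
have -> : (o0 != o1) by rewrite -(inj_eq val_inj) /=; lia.
rewrite -![(st + _)%N]/(val (block_pos _)) !wnthE /parn -/(pa _) mulnb.
by rewrite expr1 mulrN1 !mulNr !mulr1; congr (- _); rewrite mulrA mulrC.
Qed.

End PermBlock.

Local Notation wof := finfun_of_tuple.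

Definition seq_ext l (v : word l -> k) (s : seq L) : k :=
  oapp (fun t : l.-tuple L => v (wof t)) 0 (insub s).

Lemma seq_extE l (v : word l -> k) (t : l.-tuple L) : seq_ext v t = v (wof t).
Proof. by rewrite /seq_ext valK. Qed.

Lemma seq_ext_gen_asym l (w : word l) st c : (st + N <= l)%N ->
  block_asym pa N l (seq_ext (fun u => c * gen k N w st u) : seq L -> k^o).
Proof.
move=> stl; exists st => // r rN s1 a b s2 szs szn.
have sz1 : size (s1 ++ a :: b :: s2) == l by rewrite size_cat szn.
have sz2 : size (s1 ++ b :: a :: s2) == l by rewrite size_cat szn.
have rN0 : (r < N)%N by lia.
pose o0 := Ordinal rN0; pose o1 := Ordinal rN.
pose t1 := Tuple sz1; pose t2 := Tuple sz2.
have e0 : wof t1 (block_pos stl o0) = a.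
  by rewrite ffunE (tnth_nth a) /= nth_cat szs ltnn subnn.
have e1 : wof t1 (block_pos stl o1) = b.
  by rewrite ffunE (tnth_nth a) /= nth_cat szs ltnNge leq_add2l leqnSn addnS subSn // subnn.
rewrite -[s1 ++ b :: _]/(val t2) -[s1 ++ a :: _]/(val t1) !seq_extE.
have -> : wof t2 = [ffun i => wof t1 (tperm (block_pos stl o0) (block_pos stl o1) i)].
  apply/ffunP => i; rewrite ffunE [RHS]ffunE.
  case: tpermP => [->|->|].
  - by rewrite e1 (tnth_nth a) /= nth_cat szs ltnn subnn.
  - by rewrite e0 (tnth_nth a) /= nth_cat szs ltnNge leq_add2l leqnSn addnS subSn // subnn.
  move=> /eqP h0 /eqP h1; rewrite ffunE !(tnth_nth a) /= !nth_cat szs; case: ltnP => // le.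
  move: h0 h1; rewrite -!(inj_eq val_inj) /=.
  case: (i - (st + r))%N (subnKC le) => [|[|n]] //= <-; rewrite ?addn0 ?addn1 ?addnS ?eqxx //.
rewrite (@gen_swap l st stl w (wof t1) o0 o1) // e0 e1 mulrN; congr (- _).
exact: mulrCA.
Qed.

Definition asc_nat (a b : nat) : bool := (a < b)%N || (a == b) && (p <= a)%N.

Lemma bad_blockE (f : nat -> nat) st :
  bad_block N p f st = [forall r : 'I_N, (r.+1 < N)%N ==> asc_nat (f (st + r)%N) (f (st + r.+1)%N)].
Proof.
apply/existsP/forallP => [[m /forallP h] r|h].
  apply/implyP => rN; have /and4P[/implyP h1 /implyP h2 /implyP h3 /implyP h4] := h r.
  have /and4P[_ /implyP h2' _ _] := h (Ordinal rN).
  rewrite /= in h2'; rewrite /asc_nat.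
  have [lt|gt|e] := ltngtP r.+1 m; first by rewrite h3.
    have mr : (m <= r)%N by lia.
    by have /h4 : (m <= r)%N && (r.+1 < N)%N; [rewrite mr rN|have := h2 mr; lia].
  (* At the cut an even letter is followed by an odd one, which is a strict ascent. *)
  have lp := h1 (_ : r < m)%N; have pl := h2' (_ : m <= r.+1)%N.
  by apply/orP; left; apply: leq_trans (pl _); rewrite ?lp ?e // -e.
(* The cut is placed before the first odd letter, or at N if there is none; an ascent never leads
   from an odd letter back to an even one. *)
pose m := find (fun r => p <= f (st + r)%N)%N (iota 0 N).
have mN : (m <= N)%N by rewrite -[N in X in (_ <= X)%N](size_iota 0) find_size.
have mlt : (m < N.+1)%N by [].
have below r : (r < m)%N -> (f (st + r) < p)%N.
  move=> rm; have := before_find 0%N rm; rewrite nth_iota ?add0n; last by lia.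
  by move=> /negbT; rewrite -ltnNge.
have step r : (r.+1 < N)%N -> asc_nat (f (st + r)%N) (f (st + r.+1)%N).
  by move=> rN; have /implyP := h (Ordinal (ltnW rN)); apply.
have above r : (m <= r)%N -> (r < N)%N -> (p <= f (st + r))%N.
  elim: r => [|r IH] mr rN.
    have hm : has (fun r => p <= f (st + r)%N)%N (iota 0 N) by rewrite has_find size_iota -/m; lia.
    by have := nth_find 0%N hm; rewrite -/m (_ : m = 0)%N ?nth_iota //; lia.
  have [e|ne] := eqVneq m r.+1.
    have hm : has (fun r => p <= f (st + r)%N)%N (iota 0 N) by rewrite has_find size_iota -/m; lia.
    by have := nth_find 0%N hm; rewrite -/m e nth_iota.
  have mr' : (m <= r)%N by move: ne => /eqP; lia.
  have := IH mr' (ltnW rN); have := step r rN; rewrite /asc_nat.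
  by case/orP => [|/andP[/eqP<- _]]; lia.
exists (Ordinal mlt); apply/forallP => r; have rN := ltn_ord r.
apply/and4P; split; apply/implyP => /=; first exact: below.
- by move=> mr; apply: above.
- move=> rm; have rN' : (r.+1 < N)%N by lia.
  have := step r rN'; have := below r (ltnW rm); rewrite /asc_nat.
  by move=> lp /orP[//|/andP[_]]; lia.
by case/andP => mr rN'; have := step r rN'; case/orP => [/ltnW//|/andP[/eqP-> _]].
Qed.

Lemma wnth_wof l (t : l.-tuple L) j : wnth (wof t) j = nth 0%N (map val t) j.
Proof.
have [jl|lj] := ltnP j l; last by rewrite wnth_default // nth_default // size_map size_tuple.
rewrite -[j]/(val (Ordinal jl)) wnthE ffunE.
by rewrite (tnth_nth (tnth t (Ordinal jl))) (nth_map (tnth t (Ordinal jl))) // size_tuple.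
Qed.

Lemma asc_wof l (t : l.-tuple L) j : (j.+1 < l)%N ->
  asc pa t j = asc_nat (wnth (wof t) j) (wnth (wof t) j.+1).
Proof.
move=> jl; have [s1 [a [b [s2 [e szs _]]]]] := word_split (size_tuple t) jl.
rewrite !wnth_wof e -[in LHS]szs asc_split map_cat !nth_cat size_map szs ltnn subnn /=.
by rewrite ltnNge leqnSn /= subSnn.
Qed.

Lemma inLambda_wof l (t : l.-tuple L) : inLambda N (wof t) = good_word pa N t.
Proof.
apply/forallP/good_wordP => [h st|h st].
  rewrite size_tuple => stl; have stl' : (st < l.+1)%N by lia.
  have /implyP/(_ stl) := h (Ordinal stl').
  rewrite bad_blockE => /forallPn[r]; rewrite negb_imply => /andP[rN nas].
  by exists r; rewrite // asc_wof -?addnS //; lia.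
apply/implyP => stl; rewrite bad_blockE; have [|r rN nas] := h st; first by rewrite size_tuple.
apply/forallPn; exists (Ordinal (ltnW rN)); rewrite negb_imply rN /=.
by move: nas; rewrite asc_wof -?addnS //; lia.
Qed.

Lemma big_word (V : nmodType) l (F : word l -> V) :
  \sum_(w : word l) F w = \sum_(t : l.-tuple L) F (wof t).
Proof.
rewrite (reindex wof) //; exists (@tuple_of_finfun L l) => t _.
  exact: finfun_of_tupleK.
exact: tuple_of_finfunK.
Qed.

Section Coaction.
Variables (B : algType k) (x : L -> L -> B).

Definition word_seq l (w : 'I_l -> L) : seq L := [seq w i | i <- enum 'I_l].

Lemma word_seqS l (w : 'I_l.+1 -> L) :
  word_seq w = w ord0 :: word_seq (fun i => w (lift ord0 i)).
Proof. by rewrite /word_seq enum_ordSl /= -map_comp. Qed.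

Lemma parity_word_seq l (w : 'I_l -> L) :
  parity_word pa (word_seq w) = odd (\sum_(i < l) par (w i))%N.
Proof.
elim: l w => [|l IH] w; first by rewrite big_ord0 /word_seq (size0nil (size_enum_ord 0)).
by rewrite word_seqS big_ord_recl oddD /= IH oddb.
Qed.

(** The pairs with r = 0 in the double sum give the sign of one step of [coaction]; the column
    parities are collected in front. *)
Lemma coaction_word_seq l (w i : 'I_l -> L) :
  coaction pa x (word_seq w) (word_seq i)
  = (-1) ^+ (\sum_(r < l) par (i r))%N *
    ((-1) ^+ (\sum_(r < l) \sum_(s < l | (r < s)%N) (par (w r) + par (i r)) * par (w s))%N *
     \prod_(r < l) x (w r) (i r)).
Proof.
elim: l w i => [|l IH] w i.
  by rewrite !big_ord0 /word_seq (size0nil (size_enum_ord 0)) /= !mulr1.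
have -> : (\sum_(r < l.+1) \sum_(s < l.+1 | (r < s)%N) (par (w r) + par (i r)) * par (w s)
  = (par (w ord0) + par (i ord0)) * (\sum_(s < l) par (w (lift ord0 s)))
    + \sum_(r < l) \sum_(s < l | (r < s)%N)
        (par (w (lift ord0 r)) + par (i (lift ord0 r))) * par (w (lift ord0 s)))%N.
  rewrite big_ord_recl big_mkcond big_ord_recl /= add0n -big_distrr /=; congr (_ + _)%N.
  apply: eq_bigr => r _; rewrite big_mkcond big_ord_recl /= add0n [in RHS]big_mkcond.
  by apply: eq_bigr => s _; rewrite /bump /= !add1n ltnS.
rewrite !word_seqS /= IH parity_word_seq [in RHS]big_ord_recl [\prod_(r < l.+1) _]big_ord_recl.
set Q := (\sum_(s < l) par (w _))%N; set P := (\sum_(r < l) par (i _))%N.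
set S := (\sum_(r < l) \sum_(s < l | _) _)%N.
rewrite !exprD -(signr_odd _ (_ * Q)) oddM oddD /par /parn !oddb.
rewrite -!(signr_odd _ P) -!(signr_odd _ S) scaler_sign -/(pa _) -/(pa _).
move: (odd P) (odd S) (odd Q) => bP bS bQ.
by case: (pa (w ord0)); case: (pa (i ord0)); case: bP; case: bS; case: bQ;
  rewrite /= ?(expr0, expr1, mul1r, mulN1r, mulNr, mulrN, opprK).
Qed.

Lemma coaction_wof l (w i : l.-tuple L) :
  coaction pa x w i = (-1) ^+ (\sum_(r < l) par (wof i r))%N *
    ((-1) ^+ tsign (wof w) (wof i) * \prod_(r < l) x (wof w r) (wof i r)).
Proof.
have E (t : l.-tuple L) : tval t = word_seq (wof t).
  by rewrite -[in LHS](finfun_of_tupleK t).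
by rewrite !E coaction_word_seq.
Qed.

Variable coef : forall l, word l -> word l -> k.

(** Rows and columns are exchanged with respect to [coef], whose values outside Lambda are arbitrary
    and are therefore cut off. *)
Definition expansion_op l (u w : seq L) : k :=
  if good_word pa N u then seq_ext (fun wi : word l => seq_ext (fun ww => coef ww wi) w) u else 0.

Lemma expansion_opE l (u w : l.-tuple L) :
  expansion_op l u w = if good_word pa N u then coef (wof w) (wof u) else 0.
Proof. by rewrite /expansion_op !seq_extE. Qed.

Lemma Fser_reduced_trace l :
  Fser N x coef l = reduced_trace pa x expansion_op l.
Proof.
rewrite /Fser big_mkcond big_word; apply: eq_bigr => u _.
rewrite inLambda_wof; case gu: (good_word _ _ _); last first.
  by rewrite big1 // => w _; rewrite expansion_opE gu scale0r.
rewrite /Xof big_word mulr_sumr; apply: eq_bigr => w _.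
by rewrite expansion_opE gu coaction_wof -!scalerAr.
Qed.

Lemma expansion_reduction l : is_expansion N coef -> reduction pa N l (expansion_op l).
Proof.
move=> expc; split=> [u w gu|w]; first by rewrite expansion_opE (negbTE gu).
have [c cE] := expc l (wof w).
have rhoE (u : l.-tuple L) : (u == w)%:R - expansion_op l u w
    = \sum_(w' : word l) \sum_(st < l.+1 | (st + N <= l)%N) c w' st * gen k N w' st (wof u).
  rewrite -cE (inj_eq (can_inj (@finfun_of_tupleK L l))); congr (_ - _).
  rewrite expansion_opE -inLambda_wof big_mkcond (bigD1 (wof u)) //= eqxx mulr1 big1 ?addr0 //.
  by move=> i; rewrite eq_sym => /negbTE ->; rewrite mulr0; case: ifP.
(* Terms whose block does not fit are replaced by the zero tensor, which counts as [block_asym] only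
   if some block fits; for l < N the family is empty. *)
have [Nl|lN] := leqP N l; last first.
  exists 'I_0, (fun _ _ => 0); split=> [[]//|u].
  by rewrite rhoE big_ord0 big1 // => w' _; rewrite big1 // => st; lia.
exists (word l * 'I_l.+1)%type, (fun j : word l * 'I_l.+1 => if (j.2 + N <= l)%N
  then seq_ext (fun u => c j.1 j.2 * gen k N j.1 j.2 u) else fun=> 0); split=> [[w' st]|u] /=.
  case: ifP => [stl|_]; first exact: seq_ext_gen_asym.
  by exists 0%N => // r rN s1 a b s2 _ _; rewrite scaler0 oppr0.
rewrite rhoE -(pair_bigA _ (fun w' (st : 'I_l.+1) => (if (st + N <= l)%N
  then seq_ext (fun u => c w' st * gen k N w' st u) else fun=> 0) u)) /=.
apply: eq_bigr => w' _; rewrite big_mkcond; apply: eq_bigr => st _.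
by case: ifP => // _; rewrite seq_extE.
Qed.

End Coaction.

End Bridge.

(** * The logarithmic derivative of the Berezinian *)

Section JacobiFormula.
Variables (R : comPzRingType) (delta : R -> R).
Hypothesis deltaD : {morph delta : a b / a + b}.
Hypothesis deltaM : forall a b, delta (a * b) = delta a * b + a * delta b.

Let delta0 : delta 0 = 0.
Proof. by apply: (addrI (delta 0)); rewrite -deltaD !addr0. Qed.

Let deltaN a : delta (- a) = - delta a.
Proof. by apply/eqP; rewrite -addr_eq0 -deltaD addNr delta0. Qed.

Let delta1 : delta 1 = 0.
Proof. by apply: (addrI (delta 1)); rewrite addr0 -[in RHS](mulr1 1) deltaM mulr1 mul1r. Qed.

Lemma derivation_prod n (F : 'I_n -> R) :
  delta (\prod_i F i) = \sum_i \prod_j (if j == i then delta (F j) else F j).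
Proof.
elim: n F => [|n IH] F; first by rewrite !big_ord0 delta1.
rewrite big_ord_recl deltaM IH [RHS]big_ord_recl; congr (_ + _).
  by rewrite big_ord_recl eqxx; congr (_ * _); apply: eq_bigr.
rewrite mulr_sumr; apply: eq_bigr => i _; rewrite big_ord_recl (negbTE (neq_lift _ _)).
by congr (_ * _); apply: eq_bigr => j _; rewrite (inj_eq lift_inj).
Qed.

(** The derivation acts on one row at a time, and the determinant with that row derived is expanded
    along it. *)
Lemma derivation_det n (A : 'M[R]_n) :
  delta (\det A) = \tr (\adj A *m map_mx delta A).
Proof.
pose Ai i := \matrix_(j, l) (if j == i then delta (A j l) else A j l).
have -> : delta (\det A) = \sum_i \det (Ai i).
  rewrite /determinant (big_morph delta deltaD delta0) exchange_big /=.
  apply: eq_bigr => s _.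
  have -> : delta ((-1) ^+ s * \prod_i A i (s i)) = (-1) ^+ s * delta (\prod_i A i (s i)).
    by rewrite !mulr_sign; case: (odd_perm s); rewrite ?deltaN.
  rewrite derivation_prod mulr_sumr; apply: eq_bigr => i _; congr (_ * _).
  by apply: eq_bigr => j _; rewrite mxE.
rewrite mxtrace_mulC; apply: eq_bigr => i _; rewrite (expand_det_row _ i) mxE.
apply: eq_bigr => l _; rewrite !mxE eqxx; congr (_ * (_ * _)).
congr (\det _); apply/matrixP => a b; rewrite !mxE.
by rewrite eq_sym (negbTE (neq_lift _ _)).
Qed.

End JacobiFormula.

(** * Determinants with entries in a commuting subring of a noncommutative ring *)

Section CommutingSubring.
Variables (R : nzRingType) (S : R -> Prop).
Hypothesis S1 : S 1.
Hypothesis SB : forall a b, S a -> S b -> S (a - b).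
Hypothesis SM : forall a b, S a -> S b -> S (a * b).
Hypothesis SC : forall a b, S a -> S b -> a * b = b * a.

Let Spred : {pred R} := fun r => `[< S r >].

Fact Spred_closed : subring_closed Spred.
Proof.
by split=> [|a b /asboolP Sa /asboolP Sb|a b /asboolP Sa /asboolP Sb]; apply/asboolP; auto.
Qed.
HB.instance Definition _ := GRing.isSubringClosed.Build R Spred Spred_closed.

(** The elements satisfying S form a commutative ring. Matrices with such entries lift to it, so
    identities for determinants and adjugates carry over along [val]. *)
Record commuting := Commuting { commuting_val : R; commuting_valP : commuting_val \in Spred }.
HB.instance Definition _ := [isSub for commuting_val].
HB.instance Definition _ := [Choice of commuting by <:].
HB.instance Definition _ := [SubChoice_isSubNzRing of commuting by <:].

Fact commuting_S (c : commuting) : S (val c).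
Proof. by have /asboolP := valP c. Qed.

Fact commuting_mulC : commutative (@GRing.mul commuting).
Proof.
move=> a b; apply: val_inj; rewrite !rmorphM.
exact: SC (commuting_S a) (commuting_S b).
Qed.
HB.instance Definition _ := GRing.PzRing_hasCommutativeMul.Build commuting commuting_mulC.

Lemma commuting_lift m n (A : 'M[R]_(m, n)) : (forall i j, S (A i j)) ->
  exists A' : 'M[commuting]_(m, n), A = map_mx val A'.
Proof.
move=> SA; exists (\matrix_(i, j) Commuting (introT (asboolP _) (SA i j))).
by apply/matrixP => i j; rewrite !mxE.
Qed.

Lemma commuting_det n (A : 'M[R]_n) : (forall i j, S (A i j)) -> S (\det A).
Proof.
by case/commuting_lift => A' ->; rewrite det_map_mx; exact: commuting_S.
Qed.

Lemma commuting_adj n (A : 'M[R]_n) : (forall i j, S (A i j)) -> forall i j, S (\adj A i j).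
Proof.
by case/commuting_lift => A' -> i j; rewrite -map_mx_adj mxE; exact: commuting_S.
Qed.

Lemma commuting_mul_adj n (A : 'M[R]_n) : (forall i j, S (A i j)) -> \adj A *m A = (\det A)%:M.
Proof.
by case/commuting_lift => A' ->; rewrite -map_mx_adj -map_mxM mul_adj_mx map_scalar_mx det_map_mx.
Qed.

Variable delta : R -> R.
Hypothesis deltaD : {morph delta : a b / a + b}.
Hypothesis deltaM : forall a b, delta (a * b) = delta a * b + a * delta b.
Hypothesis deltaS : forall a, S a -> S (delta a).

Lemma commuting_derivation_det n (A : 'M[R]_n) : (forall i j, S (A i j)) ->
  delta (\det A) = \tr (\adj A *m map_mx delta A).
Proof.
case/commuting_lift => A' ->.
have Sd (c : commuting) : delta (val c) \in Spred.
  by apply/asboolP/deltaS/commuting_S.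
pose delta' c := Commuting (Sd c).
have d'D : {morph delta' : a b / a + b}.
  by move=> a b; apply: val_inj; rewrite -[LHS]/(delta (val (a + b))) !rmorphD deltaD.
have d'M a b : delta' (a * b) = delta' a * b + a * delta' b.
  by apply: val_inj; rewrite -[LHS]/(delta (val (a * b))) rmorphM deltaM rmorphD !rmorphM.
rewrite det_map_mx -[delta _]/(val (delta' _)) (derivation_det d'D d'M).
rewrite -map_mx_adj -trace_map_mx map_mxM; congr (\tr (_ *m _)).
by apply/matrixP => i j; rewrite !mxE.
Qed.

End CommutingSubring.

(** * Parity in an algebra without a grading *)

Section SuperCommutant.
Variables (d : nat) (pa : 'I_d -> bool) (k : fieldType) (B : algType k).
Local Notation L := 'I_d.
Variable x : L -> L -> B.
Hypothesis xC : supercommutes pa x x.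

(** The supercommutant of the entries of x, in parity s. *)
Definition twisted (s : bool) (b : B) : Prop :=
  forall a c, b * x a c = (-1) ^+ (s && (pa a (+) pa c)) *: (x a c * b).

(* The double supercommutant of the entries of x: it contains them, and its
   homogeneous elements supercommute with each other by definition. *)
Definition homog (s : bool) (b : B) : Prop :=
  twisted s b /\ forall r z, twisted r z -> b * z = (-1) ^+ (s && r) *: (z * b).

Lemma homog_comm s r b c : homog s b -> homog r c -> b * c = (-1) ^+ (s && r) *: (c * b).
Proof. by move=> [_ hb] [hc _]; apply: hb. Qed.

Lemma homog_x a c : homog (pa a (+) pa c) (x a c).
Proof.
split=> [e f|r z tz]; first exact: xC.
by rewrite tz andbC scalerA -expr2 sqrr_sign scale1r.
Qed.

Lemma homogM s r b c : homog s b -> homog r c -> homog (s (+) r) (b * c).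
Proof.
move=> [tb hb] [tc hc]; split=> [e f|t z tz].
  rewrite -mulrA tc -scalerAr [b * (_ * _)]mulrA tb -scalerAl scalerA !mulrA -signr_addb.
  by congr ((-1) ^+ nat_of_bool _ *: _); case: s {tb hb}; case: r {tc hc}; case: (pa e); case: (pa f).
rewrite -mulrA (hc _ _ tz) -scalerAr [b * (_ * _)]mulrA (hb _ _ tz) -scalerAl scalerA !mulrA -signr_addb.
by congr ((-1) ^+ nat_of_bool _ *: _); case: s {tb hb}; case: r {tc hc}; case: t {tz}.
Qed.

Lemma homogB s b c : homog s b -> homog s c -> homog s (b - c).
Proof.
move=> [tb hb] [tc hc]; split=> [e f|t z tz]; rewrite mulrBl mulrBr scalerBr.
  by rewrite tb tc.
by rewrite (hb _ _ tz) (hc _ _ tz).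
Qed.

Lemma homog0 s : homog s 0.
Proof. by split=> [a c|r z _]; rewrite mul0r mulr0 scaler0. Qed.

Lemma homogD s b c : homog s b -> homog s c -> homog s (b + c).
Proof.
move=> hb hc; rewrite -[c]opprK -[- c]sub0r; apply: homogB => //; apply: homogB => //.
exact: homog0.
Qed.

Lemma homog1 : homog false 1.
Proof. by split=> [a c|r z _]; rewrite mul1r mulr1 expr0 scale1r. Qed.

Lemma homog_sum s (I : Type) (r : seq I) (P : pred I) (F : I -> B) :
  (forall i, P i -> homog s (F i)) -> homog s (\sum_(i <- r | P i) F i).
Proof. move=> h; apply: big_ind => //; [exact: homog0|exact: homogD]. Qed.

Definition homogp (s : bool) (f : {poly B}) : Prop := forall i, homog s f`_i.

Lemma homogpM s r f g : homogp s f -> homogp r g -> homogp (s (+) r) (f * g).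
Proof. by move=> hf hg i; rewrite coefM; apply: homog_sum => j _; apply: homogM. Qed.

Lemma homogpB s f g : homogp s f -> homogp s g -> homogp s (f - g).
Proof. by move=> hf hg i; rewrite coefB; apply: homogB. Qed.

Lemma homogpD s f g : homogp s f -> homogp s g -> homogp s (f + g).
Proof. by move=> hf hg i; rewrite coefD; apply: homogD. Qed.

Lemma homogp0 s : homogp s 0.
Proof. by move=> i; rewrite coef0; apply: homog0. Qed.

Lemma homogp1 : homogp false 1.
Proof. by move=> i; rewrite coef1; case: (i == 0)%N; [exact: homog1|exact: homog0]. Qed.

Lemma homogp_comm s r f g : homogp s f -> homogp r g ->
  f * g = if s && r then - (g * f) else g * f.
Proof.
move=> hf hg; apply/polyP => i; rewrite (fun_if (fun h : {poly B} => h`_i)) coefN coefM coefMr.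
case sr: (s && r); rewrite -?sumrN; apply: eq_bigr => j _;
  by rewrite (homog_comm (hf _) (hg _)) sr ?expr1 ?expr0 ?scaleN1r ?scale1r.
Qed.

Lemma homogp_commute s f g : homogp false f -> homogp s g -> f * g = g * f.
Proof. by move=> hf hg; rewrite (homogp_comm hf hg). Qed.

Definition homogmx (s : bool) m n (A : 'M[{poly B}]_(m, n)) : Prop :=
  forall i j, homogp s (A i j).

Lemma homogp_sum s (I : Type) (r : seq I) (P : pred I) (F : I -> {poly B}) :
  (forall i, P i -> homogp s (F i)) -> homogp s (\sum_(i <- r | P i) F i).
Proof. move=> h; apply: big_ind => //; [exact: homogp0|exact: homogpD]. Qed.

Lemma homogmxM s r m n l (A : 'M_(m, n)) (C : 'M_(n, l)) :
  homogmx s A -> homogmx r C -> homogmx (s (+) r) (A *m C).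
Proof. by move=> hA hC i j; rewrite mxE; apply: homogp_sum => h _; apply: homogpM. Qed.

Lemma homogmx_mxtrace s n (A : 'M_n) : homogmx s A -> homogp s (\tr A).
Proof. by move=> hA; apply: homogp_sum. Qed.

Lemma homogmxB s m n (A C : 'M_(m, n)) : homogmx s A -> homogmx s C -> homogmx s (A - C).
Proof. by move=> hA hC i j; rewrite !mxE; apply: homogpB. Qed.

Lemma homogmxD s m n (A C : 'M_(m, n)) : homogmx s A -> homogmx s C -> homogmx s (A + C).
Proof. by move=> hA hC i j; rewrite !mxE; apply: homogpD. Qed.

Lemma homogmx1 n : homogmx false (1%:M : 'M_n).
Proof. by move=> i j; rewrite mxE; case: (i == j); [exact: homogp1|exact: homogp0]. Qed.

(** Exchanging the factors costs a sign exactly for two odd blocks; this is the invariance of the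
    supertrace, block by block. *)
Lemma mxtrace_swap s r m n (P : 'M_(m, n)) (Q : 'M_(n, m)) :
  homogmx s P -> homogmx r Q ->
  \tr (P *m Q) = if s && r then - \tr (Q *m P) else \tr (Q *m P).
Proof.
move=> hP hQ; rewrite /mxtrace; under eq_bigr do rewrite mxE.
under [X in if _ then - X else X]eq_bigr do rewrite mxE.
rewrite exchange_big; case sr: (s && r); rewrite -?sumrN; apply: eq_bigr => j _;
  rewrite -?sumrN; apply: eq_bigr => i _; by rewrite (homogp_comm (hP i j) (hQ j i)) sr.
Qed.

(** The operator t d/dt. It preserves degrees, hence congruences modulo t^M, and fixes the entries
    of tX. *)
Definition euler (f : {poly B}) : {poly B} := 'X * f^`().

Lemma coef_euler f i : (euler f)`_i = f`_i *+ i.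
Proof. by case: i => [|i]; rewrite /euler coefXM ?mulr0n //= coef_deriv. Qed.

Lemma eulerD : {morph euler : f g / f + g}.
Proof. by move=> f g; rewrite /euler derivD mulrDr. Qed.

Lemma eulerM f g : euler (f * g) = euler f * g + f * euler g.
Proof.
rewrite /euler derivM mulrDr !mulrA; congr (_ + _ * _).
exact/esym/commr_polyX.
Qed.

Lemma homogp_euler s f : homogp s f -> homogp s (euler f).
Proof.
move=> hf i; rewrite coef_euler; move: (hf i); move: f`_i => b hb.
by elim: i => [|i IH]; rewrite ?mulr0n ?mulrS; [exact: homog0|exact: homogD].
Qed.

Lemma homogp_det n (A : 'M_n) : homogmx false A -> homogp false (\det A).
Proof.
apply: (@commuting_det _ (homogp false)) => [|f g|f g];
  [exact: homogp1|exact: homogpB|exact: homogpM].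
Qed.

Lemma homogmx_adj n (A : 'M_n) : homogmx false A -> homogmx false (\adj A).
Proof.
move=> hA i j; move: i j.
apply: (@commuting_adj _ (homogp false)) => // [|f g|f g];
  [exact: homogp1|exact: homogpB|exact: homogpM].
Qed.

Lemma homogmx_mul_adj n (A : 'M_n) : homogmx false A -> \adj A *m A = (\det A)%:M.
Proof.
apply: (@commuting_mul_adj _ (homogp false)) => [|f g|f g|f g];
  [exact: homogp1|exact: homogpB|exact: homogpM|exact: homogp_commute].
Qed.

Lemma euler_det n (A : 'M_n) : homogmx false A ->
  euler (\det A) = \tr (\adj A *m map_mx euler A).
Proof.
apply: (@commuting_derivation_det _ (homogp false)) => [|f g|f g|f g| | |f];
  [exact: homogp1|exact: homogpB|exact: homogpM|exact: homogp_commute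
  |exact: eulerD|exact: eulerM|exact: homogp_euler].
Qed.

Lemma euler_mulmx m n l (A : 'M_(m, n)) (C : 'M_(n, l)) :
  map_mx euler (A *m C) = map_mx euler A *m C + A *m map_mx euler C.
Proof.
apply/matrixP => i j; rewrite !mxE (big_morph euler eulerD (_ : euler 0 = 0)).
  by rewrite -big_split; apply: eq_bigr => h _; rewrite eulerM !mxE.
by rewrite /euler deriv0 mulr0.
Qed.

End SuperCommutant.

(** * Congruence modulo t^M *)

Section TruncatedCongruence.
Variables (R : nzRingType) (M : nat).

Definition eqt (f g : {poly R}) : Prop := forall i, (i < M)%N -> f`_i = g`_i.

Global Instance eqt_equiv : Equivalence eqt.
Proof.
split=> [f i //|f g h i iM|f g h h1 h2 i iM]; first by rewrite h.
by rewrite h1 ?h2.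
Qed.

Lemma eqtD f f' g g' : eqt f f' -> eqt g g' -> eqt (f + g) (f' + g').
Proof. by move=> hf hg i iM; rewrite !coefD hf ?hg. Qed.

Lemma eqtN f f' : eqt f f' -> eqt (- f) (- f').
Proof. by move=> hf i iM; rewrite !coefN hf. Qed.

Lemma eqtM f f' g g' : eqt f f' -> eqt g g' -> eqt (f * g) (f' * g').
Proof.
move=> hf hg i iM; rewrite !coefM; apply: eq_bigr => j _.
by rewrite hf ?hg //; have := ltn_ord j; lia.
Qed.

Global Instance eqt_add : Proper (eqt ==> eqt ==> eqt) +%R.
Proof. by move=> f f' hf g g' hg; apply: eqtD. Qed.

Global Instance eqt_opp : Proper (eqt ==> eqt) -%R.
Proof. by move=> f f' hf; apply: eqtN. Qed.

Global Instance eqt_mul : Proper (eqt ==> eqt ==> eqt) *%R.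
Proof. by move=> f f' hf g g' hg; apply: eqtM. Qed.

Lemma eqt_sum (I : Type) (r : seq I) (P : pred I) (F G : I -> {poly R}) :
  (forall i, P i -> eqt (F i) (G i)) -> eqt (\sum_(i <- r | P i) F i) (\sum_(i <- r | P i) G i).
Proof. by move=> h; apply: big_ind2 => // f f' g g'; apply: eqtD. Qed.

Lemma eqt_prod (I : Type) (r : seq I) (P : pred I) (F G : I -> {poly R}) :
  (forall i, P i -> eqt (F i) (G i)) -> eqt (\prod_(i <- r | P i) F i) (\prod_(i <- r | P i) G i).
Proof. by move=> h; apply: big_ind2 => // f f' g g'; apply: eqtM. Qed.

Definition eqtmx m n (A C : 'M[{poly R}]_(m, n)) : Prop := forall i j, eqt (A i j) (C i j).

Global Instance eqtmx_equiv m n : Equivalence (@eqtmx m n).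
Proof.
split=> [A i j //|A C h i j|A C D h1 h2 i j]; first by symmetry; apply: h.
by transitivity (C i j).
Qed.

Global Instance eqtmx_add m n : Proper (@eqtmx m n ==> @eqtmx m n ==> @eqtmx m n) +%R.
Proof. by move=> A A' hA C C' hC i j; rewrite !mxE; apply: eqtD. Qed.

Global Instance eqtmx_opp m n : Proper (@eqtmx m n ==> @eqtmx m n) -%R.
Proof. by move=> A A' hA i j; rewrite !mxE; apply: eqtN. Qed.

Global Instance eqtmx_mul m n l : Proper (@eqtmx m n ==> @eqtmx n l ==> @eqtmx m l) mulmx.
Proof. by move=> A A' hA C C' hC i j; rewrite !mxE; apply: eqt_sum => h _; apply: eqtM. Qed.

Global Instance eqtmx_scale m n : Proper (eqt ==> @eqtmx m n ==> @eqtmx m n) *:%R.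
Proof. by move=> f f' hf A A' hA i j; rewrite !mxE; apply: eqtM. Qed.

Global Instance eqtmx_trace n : Proper (@eqtmx n n ==> eqt) mxtrace.
Proof. by move=> A A' hA; apply: eqt_sum => i _; apply: hA. Qed.

Global Instance eqtmx_scalar n : Proper (eqt ==> @eqtmx n n) scalar_mx.
Proof. by move=> f f' hf i j; rewrite !mxE; case: (i == j). Qed.

Lemma eqtmx_det n (A C : 'M[{poly R}]_n) : eqtmx A C -> eqt (\det A) (\det C).
Proof.
by move=> h; apply: eqt_sum => s _; apply: eqtM => //; apply: eqt_prod => i _; apply: h.
Qed.

End TruncatedCongruence.

Lemma mul_eqt0 (R : nzRingType) a b (f g : {poly R}) :
  eqt a f 0 -> eqt b g 0 -> eqt (a + b) (f * g) 0.
Proof.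
move=> hf hg i iM; rewrite coefM coef0 big1 // => j _.
have [ja|aj] := ltnP j a; first by rewrite hf // coef0 mul0r.
by rewrite hg ?coef0 ?mulr0 //; have := ltn_ord j; lia.
Qed.

Lemma iter_mulmx_eqt0 (R : nzRingType) n (A : 'M[{poly R}]_n) j :
  eqtmx 1 A 0 -> eqtmx j (iter j (mulmx A) 1%:M) 0.
Proof.
move=> hA; elim: j => [|j IH] a b; first by [].
rewrite /= !mxE -[j.+1]add1n => i ij; rewrite coef0 coef_sum big1 // => l _.
rewrite (mul_eqt0 (a := 1) (b := j)) ?coef0 //.
  by have := hA a l; rewrite mxE.
by have := IH l b; rewrite mxE.
Qed.

Lemma exp_eqt0 (R : nzRingType) (f : {poly R}) j : eqt 1 f 0 -> eqt j (f ^+ j) 0.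
Proof.
move=> hf; elim: j => [|j IH]; first by [].
by rewrite exprS -[j.+1]add1n; apply: mul_eqt0.
Qed.

Section GeometricSeries.
Variable R : nzRingType.

Lemma iter_mulmxC n (A : 'M[R]_n) j : iter j (mulmx A) 1%:M *m A = A *m iter j (mulmx A) 1%:M.
Proof. by elim: j => [|j IH] /=; rewrite ?mul1mx ?mulmx1 // -mulmxA IH. Qed.

Lemma geometric_mulmx n (A : 'M[R]_n) M :
  (1%:M - A) *m (\sum_(j < M) iter j (mulmx A) 1%:M) = 1%:M - iter M (mulmx A) 1%:M.
Proof.
elim: M => [|M IH]; first by rewrite big_ord0 mulmx0 subrr.
by rewrite big_ord_recr /= mulmxDr IH mulmxBl mul1mx addrA subrK.
Qed.

Lemma mulmx_geometric n (A : 'M[R]_n) M :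
  (\sum_(j < M) iter j (mulmx A) 1%:M) *m (1%:M - A) = 1%:M - iter M (mulmx A) 1%:M.
Proof.
rewrite -geometric_mulmx mulmxBr mulmxBl mulmx1 mul1mx mulmx_suml mulmx_sumr.
by congr (_ - _); apply: eq_bigr => j _; apply: iter_mulmxC.
Qed.

(* [det1] assumes commutativity *)
Lemma det_mx1 n : \det (1%:M : 'M[R]_n) = 1.
Proof. by rewrite -(map_mx1 (intmul (1 : R))) det_map_mx det1 rmorph1. Qed.

End GeometricSeries.

(** * The logarithmic derivative through Schur complements *)

Section Berezinian.
Variables (k : fieldType) (p q : nat) (B : algType k).
Hypothesis char0 : [pchar k] =i pred0.
Local Notation L := 'I_(p + q).
Local Notation pa := (@odd_letter p q).
Variable x : L -> L -> B.
Hypothesis xC : supercommutes pa x x.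
Variable M : nat.
Local Notation homogp := (homogp pa x).
Local Notation homogmx := (homogmx pa x).

Lemma homogp_tX a b : homogp (pa a (+) pa b) (tX x a b).
Proof.
move=> i; rewrite coefMX coefC; case: i => [|[|i]] /=; [exact: homog0|exact: homog_x|exact: homog0].
Qed.

Lemma odd_lshift a : pa (lshift q a) = false.
Proof. by rewrite /odd_letter leqNgt /= ltn_ord. Qed.

Lemma odd_rshift b : pa (rshift p b) = true.
Proof. by rewrite /odd_letter /= leq_addr. Qed.

Lemma homogmx_A0 : homogmx false (A0 x).
Proof. by move=> i j; rewrite mxE; have := homogp_tX (lshift q i) (lshift q j); rewrite !odd_lshift. Qed.

Lemma homogmx_D0 : homogmx false (D0 x).
Proof. by move=> i j; rewrite mxE; have := homogp_tX (rshift p i) (rshift p j); rewrite !odd_rshift. Qed.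

Lemma homogmx_B0 : homogmx true (B0 x).
Proof.
by move=> i j; rewrite mxE; have := homogp_tX (lshift q i) (rshift p j); rewrite odd_lshift odd_rshift.
Qed.

Lemma homogmx_C0 : homogmx true (C0 x).
Proof.
by move=> i j; rewrite mxE; have := homogp_tX (rshift p i) (lshift q j); rewrite odd_lshift odd_rshift.
Qed.

Lemma eqt_tX a b : eqt 1 (tX x a b) 0.
Proof. by case=> // _; rewrite coefMX coef0. Qed.

Lemma euler_tX a b : euler (tX x a b) = tX x a b.
Proof.
by rewrite /euler /tX derivM derivX mulr1 derivC mul0r add0r commr_polyX.
Qed.

Lemma homogmx_iter n (A : 'M[{poly B}]_n) j :
  homogmx false A -> homogmx false (iter j (mulmx A) 1%:M).
Proof.
move=> hA; elim: j => [|j IH]; first exact: homogmx1.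
exact: (homogmxM hA IH).
Qed.

Lemma homogmx_N n m (A : 'M[{poly B}]_(n, m)) s : homogmx s A -> homogmx s (- A).
Proof.
by move=> hA i j; rewrite !mxE -[- _]sub0r; apply: homogpB => //; apply: homogp0.
Qed.

Local Notation G := (Ainv x M).

Lemma homogmx_Ainv : homogmx false G.
Proof.
move=> i j; rewrite summxE; apply: homogp_sum => h _.
by apply: homogmx_iter; apply: homogmx_N; apply: homogmx_A0.
Qed.

Lemma eqtmx_NA0 : eqtmx M (iter M (mulmx (- A0 x)) 1%:M) 0.
Proof.
by apply: iter_mulmx_eqt0 => i j; rewrite !mxE -oppr0; apply: eqtN; apply: eqt_tX.
Qed.

Lemma Ainv_l : eqtmx M (G *m (1%:M + A0 x)) 1%:M.
Proof. by rewrite -[X in 1%:M + X]opprK /Ainv mulmx_geometric eqtmx_NA0 subr0. Qed.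

Lemma Ainv_r : eqtmx M ((1%:M + A0 x) *m G) 1%:M.
Proof. by rewrite -[X in 1%:M + X]opprK /Ainv geometric_mulmx eqtmx_NA0 subr0. Qed.

Local Notation A := (A0 x).
Local Notation Bq := (B0 x).
Local Notation C := (C0 x).
Local Notation D := (D0 x).
Local Notation Sc := (Defs.Schur x M).
Local Notation detA := (\det (1%:M + A)).
Local Notation detS := (\det Sc).
Local Notation detS_inverse := (\sum_(j < M) (1 - detS) ^+ j).
(** Cramer's formula for the inverse of the Schur complement modulo t^M. *)
Local Notation H := (detS_inverse *: \adj Sc).

Lemma homogmx_Schur : homogmx false Sc.
Proof.
apply: homogmxB; first by apply: homogmxD; [exact: homogmx1|exact: homogmx_D0].
exact: (homogmxM (homogmxM homogmx_C0 homogmx_Ainv) homogmx_B0).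
Qed.

Lemma homogp_detA : homogp false detA.
Proof. by apply: homogp_det; apply: homogmxD; [exact: homogmx1|exact: homogmx_A0]. Qed.

Lemma homogp_detS : homogp false detS.
Proof. exact/homogp_det/homogmx_Schur. Qed.

Lemma homogp_inv : homogp false detS_inverse.
Proof.
apply: homogp_sum => j _; elim: {j}(val j) => [|j IH]; first exact: homogp1.
rewrite exprS; apply: (homogpM (s := false) (r := false)) => //.
by apply: homogpB; [exact: homogp1|exact: homogp_detS].
Qed.

Lemma homogmx_H : homogmx false H.
Proof.
move=> i j; rewrite mxE; apply: (homogpM (s := false) (r := false)); first exact: homogp_inv.
exact: homogmx_adj homogmx_Schur i j.
Qed.

Lemma detA_eqt1 : eqt 1 detA 1.
Proof.
have h : eqtmx 1 (1%:M + A) 1%:M.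
  have A0 : eqtmx 1 A 0 by move=> i j; rewrite !mxE; apply: eqt_tX.
  by rewrite A0 addr0.
by have := eqtmx_det h; rewrite det_mx1.
Qed.

Lemma detS_eqt1 : eqt 1 detS 1.
Proof.
have h : eqtmx 1 Sc 1%:M.
  have D0 : eqtmx 1 D 0 by move=> i j; rewrite !mxE; apply: eqt_tX.
  have C0 : eqtmx 1 C 0 by move=> i j; rewrite !mxE; apply: eqt_tX.
  by rewrite /Defs.Schur D0 C0 !mul0mx subr0 addr0.
by have := eqtmx_det h; rewrite det_mx1.
Qed.

(** 1 - [detS] has no constant term, so the geometric series telescopes to 1 modulo t^M. *)
Lemma detS_inv : eqt M (detS * detS_inverse) 1.
Proof.
have -> : detS * detS_inverse = 1 - (1 - detS) ^+ M.
  have := subrX1 (1 - detS) M; rewrite [X in _ = X * _]addrAC subrr add0r mulNr => /(congr1 -%R).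
  by rewrite opprK opprB.
have h : eqt 1 (1 - detS) 0 by rewrite detS_eqt1 subrr.
by rewrite (exp_eqt0 (j := M) h) subr0.
Qed.

Lemma inv_detS : eqt M (detS_inverse * detS) 1.
Proof. rewrite (homogp_commute homogp_inv homogp_detS); exact: detS_inv. Qed.

Lemma mul_H_Schur : eqtmx M (H *m Sc) 1%:M.
Proof.
by rewrite -scalemxAl (homogmx_mul_adj homogmx_Schur) scale_scalar_mx inv_detS.
Qed.

Lemma euler_eqt (f g : {poly B}) : eqt M f g -> eqt M (euler f) (euler g).
Proof. by move=> h i iM; rewrite !coef_euler h. Qed.

Lemma euler1 : euler (1 : {poly B}) = 0.
Proof. by rewrite /euler derivC mulr0. Qed.

Lemma map_euler1 n : map_mx (@euler k B) (1%:M : 'M_n) = 0.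
Proof.
by apply/matrixP => i j; rewrite !mxE; case: (i == j); rewrite ?euler1 // /euler deriv0 mulr0.
Qed.

Lemma map_eulerD n m (P Q : 'M[{poly B}]_(n, m)) :
  map_mx (@euler k B) (P + Q) = map_mx (@euler k B) P + map_mx (@euler k B) Q.
Proof. by apply/matrixP => i j; rewrite !mxE eulerD. Qed.

Lemma map_eulerN n m (P : 'M[{poly B}]_(n, m)) :
  map_mx (@euler k B) (- P) = - map_mx (@euler k B) P.
Proof. by apply/matrixP => i j; rewrite !mxE /euler derivN mulrN. Qed.

(** Jacobi's formula, with the adjugate rewritten as [detA] times the inverse [G]. *)
Lemma euler_detA : eqt M (euler detA) (detA * \tr (G *m A)).
Proof.
have hA : homogmx false (1%:M + A) by apply: homogmxD; [exact: homogmx1|exact: homogmx_A0].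
rewrite (euler_det hA) map_eulerD map_euler1 add0r.
have -> : map_mx (@euler k B) A = A by apply/matrixP => i j; rewrite !mxE euler_tX.
have e : eqtmx M (\adj (1%:M + A)) (detA *: G).
  transitivity (\adj (1%:M + A) *m ((1%:M + A) *m G)); first by rewrite Ainv_r mulmx1.
  by rewrite mulmxA (homogmx_mul_adj hA) mul_scalar_mx.
by rewrite e -scalemxAl mxtraceZ.
Qed.

Lemma euler_detS : eqt M (euler detS) (detS * \tr (H *m map_mx (@euler k B) Sc)).
Proof.
rewrite (euler_det homogmx_Schur).
have e : eqtmx M (\adj Sc) (detS *: H) by rewrite scalerA detS_inv scale1r.
transitivity (\tr ((detS *: H) *m map_mx (@euler k B) Sc)); last by rewrite -[(detS *: H) *m _]scalemxAl mxtraceZ.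
by apply: eqtmx_trace; apply: eqtmx_mul.
Qed.

Lemma euler_inv : eqt M (euler detS_inverse) (- (detS_inverse * euler detS * detS_inverse)).
Proof.
have h : eqt M (euler detS * detS_inverse + detS * euler detS_inverse) 0.
  by rewrite -eulerM; have := euler_eqt detS_inv; rewrite euler1.
have h2 : eqt M (detS_inverse * euler detS * detS_inverse + euler detS_inverse) 0.
  transitivity (detS_inverse * euler detS * detS_inverse + detS_inverse * detS * euler detS_inverse); first by rewrite inv_detS mul1r.
  by rewrite -[detS_inverse * _ * _]mulrA -[detS_inverse * detS * _]mulrA -mulrDr h mulr0.
transitivity (- (detS_inverse * euler detS * detS_inverse) + (detS_inverse * euler detS * detS_inverse + euler detS_inverse)).
  by rewrite addrA addNr add0r.
by rewrite h2 addr0.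
Qed.

(** The logarithmic derivative of a quotient is a difference; the factors may be reordered because
    all of them are even. *)
Lemma euler_ber : eqt M (euler (ber_tr x M))
  ((\tr (G *m A) - \tr (H *m map_mx (@euler k B) Sc)) * ber_tr x M).
Proof.
have hG : homogp false (\tr (G *m A)).
  by apply: homogmx_mxtrace; apply: (homogmxM homogmx_Ainv homogmx_A0).
have hH : homogp false (\tr (H *m map_mx (@euler k B) Sc)).
  apply: homogmx_mxtrace; apply: (homogmxM homogmx_H) => i j; rewrite mxE.
  exact/homogp_euler/homogmx_Schur.
rewrite /ber_tr eulerM euler_detA euler_inv euler_detS mulrN.
rewrite !mulrA -[detA * detS_inverse * detS]mulrA inv_detS mulr1 -mulrBl -mulrBr.
by rewrite (homogp_commute homogp_detA (homogpB hG hH)).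
Qed.

Local Notation W := (\tr (G *m A) - \tr (H *m map_mx (@euler k B) Sc)).

Definition blocktrace (R : nzRingType) (P : 'M[R]_(p + q)) : R :=
  \tr (ulsubmx P) - \tr (drsubmx P).

Lemma blocktrace_sum (R : nzRingType) n (P : 'I_n -> 'M[R]_(p + q)) :
  blocktrace (\sum_j P j) = \sum_j blocktrace (P j).
Proof.
apply: (big_morph (@blocktrace R)) => [P1 P2|]; rewrite /blocktrace.
  have -> : ulsubmx (P1 + P2) = ulsubmx P1 + ulsubmx P2 by apply/matrixP => i j; rewrite !mxE.
  have -> : drsubmx (P1 + P2) = drsubmx P1 + drsubmx P2 by apply/matrixP => i j; rewrite !mxE.
  by rewrite !mxtraceD opprD addrACA.
by rewrite /mxtrace !big1 ?subr0 // => i _; rewrite !mxE.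
Qed.

Lemma blocktrace_eqt (P Q : 'M[{poly B}]_(p + q)) :
  eqtmx M P Q -> eqt M (blocktrace P) (blocktrace Q).
Proof.
move=> h; apply: eqtD; last apply: eqtN; apply: eqtmx_trace => i j; rewrite !mxE; apply: h.
Qed.

Definition tXmx : 'M[{poly B}]_(p + q) := \matrix_(u, v) tX x u v.

Lemma tXmxE : tXmx = block_mx A Bq C D.
Proof. by rewrite -[LHS]submxK; congr block_mx; apply/matrixP => i j; rewrite !mxE. Qed.

(* The inverse of 1 + tX, by Schur complementation. *)
Definition schur_inverse : 'M[{poly B}]_(p + q) :=
  block_mx (G + G *m Bq *m H *m C *m G) (- (G *m Bq *m H)) (- (H *m C *m G)) H.

Lemma schur_inverse_l : eqtmx M (schur_inverse *m (1%:M + tXmx)) 1%:M.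
Proof.
have e1 : eqtmx M (H *m (1%:M + D)) (1%:M + H *m C *m G *m Bq).
  transitivity (H *m Sc + H *m C *m G *m Bq); last by rewrite mul_H_Schur.
  by rewrite /Defs.Schur mulmxBr !mulmxA subrK.
rewrite tXmxE (scalar_mx_block p q 1) add_block_mx !add0r mulmx_block.
have eqt_block n1 n2 m1 m2 (P P' : 'M[{poly B}]_(n1, m1)) (Q Q' : 'M[{poly B}]_(n1, m2))
    (U U' : 'M[{poly B}]_(n2, m1)) (V V' : 'M[{poly B}]_(n2, m2)) :
    eqtmx M P P' -> eqtmx M Q Q' -> eqtmx M U U' -> eqtmx M V V' ->
    eqtmx M (block_mx P Q U V) (block_mx P' Q' U' V').
  by move=> hP hQ hU hV i j; rewrite !mxE; case: splitP => i' _; rewrite !mxE; case: splitP.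
apply: eqt_block.
- rewrite mulmxDl -(mulmxA _ G (1%:M + A)) Ainv_l mulmx1 mulNmx.
  by rewrite addrK.
- rewrite mulNmx -(mulmxA _ H (1%:M + D)) e1 mulmxDr mulmx1 mulmxDl !mulmxA.
  by rewrite subrr.
- by rewrite mulNmx -(mulmxA _ G (1%:M + A)) Ainv_l mulmx1 addNr.
by rewrite e1 mulNmx addrC addrK.
Qed.

(** A left inverse and a right inverse of 1 + tX agree modulo t^M. *)
Lemma schur_inverse_geometric :
  eqtmx M schur_inverse (\sum_(j < M) iter j (mulmx (- tXmx)) 1%:M).
Proof.
set S := \sum_(j < M) _.
have h : eqtmx M ((1%:M + tXmx) *m S) 1%:M.
  rewrite -[X in 1%:M + X]opprK /S geometric_mulmx.
  have -> : eqtmx M (iter M (mulmx (- tXmx)) 1%:M) 0; last by rewrite subr0.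
  by apply: iter_mulmx_eqt0 => i j; rewrite !mxE -oppr0; apply: eqtN; apply: eqt_tX.
transitivity (schur_inverse *m ((1%:M + tXmx) *m S)); first by rewrite h mulmx1.
by rewrite mulmxA schur_inverse_l mul1mx.
Qed.

(** Applying [euler] to G (1 + A) = 1 gives -G A G for the derivative of G, while A, B', C and D are
    fixed, being linear in t. *)
Lemma euler_Schur : eqtmx M (map_mx (@euler k B) Sc)
  (D - (C *m G *m Bq - C *m G *m A *m G *m Bq + C *m G *m Bq)).
Proof.
have eG : eqtmx M (map_mx (@euler k B) G) (- (G *m A *m G)).
  have eA : map_mx (@euler k B) A = A by apply/matrixP => i j; rewrite !mxE euler_tX.
  have h : eqtmx M (map_mx (@euler k B) G *m (1%:M + A) + G *m A) 0.
    rewrite -[X in _ + G *m X]eA -[X in _ + G *m X]add0r -(map_euler1 p) -map_eulerD -euler_mulmx.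
    by move=> i j; rewrite mxE [X in eqt _ _ X]mxE; apply: euler_eqt; apply: Ainv_l.
  transitivity ((map_mx (@euler k B) G *m (1%:M + A) + G *m A) *m G - G *m A *m G).
    by rewrite mulmxDl addrK -mulmxA Ainv_r mulmx1.
  by rewrite h mul0mx add0r.
have eBCD (m n : nat) (P : 'M[{poly B}]_(m, n)) : (forall i j, euler (P i j) = P i j) ->
    map_mx (@euler k B) P = P.
  by move=> h; apply/matrixP => i j; rewrite mxE h.
rewrite /Defs.Schur map_eulerD map_eulerN map_eulerD map_euler1 add0r !euler_mulmx.
rewrite (eBCD _ _ D) ?(eBCD _ _ C) ?(eBCD _ _ Bq); try by move=> i j; rewrite mxE euler_tX.
by rewrite eG mulmxN mulmxDl mulNmx !mulmxA.
Qed.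

(** Expanded into traces, the two sides differ by exchanging the odd factor G B' with H C in one
    term and with H C G A in another; the signs so produced make them agree. *)
Lemma logderiv_blocktrace : eqt M W (blocktrace (schur_inverse *m tXmx)).
Proof.
rewrite euler_Schur tXmxE mulmx_block /blocktrace block_mxKul block_mxKdr.
rewrite mulmxDl !mulNmx !mulmxBr !mulmxDr !mulmxN !mulmxA.
rewrite !(mxtraceD, raddfN) /= !(mxtraceD, raddfN) /=.
have hHC : homogmx true (H *m C) := homogmxM homogmx_H homogmx_C0.
have hGB : homogmx true (G *m Bq) := homogmxM homogmx_Ainv homogmx_B0.
have hHCGA : homogmx true (H *m C *m G *m A).
  exact: (homogmxM (homogmxM hHC homogmx_Ainv) homogmx_A0).
have e1 := mxtrace_swap hHC hGB; have e2 := mxtrace_swap hHCGA hGB.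
rewrite /= !mulmxA in e1 e2.
rewrite e1 e2 !opprD !opprK !addrA.
by rewrite [X in eqt _ _ X](ACl (1 * 5 * 3 * 2 * 4)%AC).
Qed.

Lemma tXmx_iter j u v :
  (iter j (mulmx (- tXmx)) 1%:M *m tXmx) u v = (-1) ^+ j * ((powX x j u v)%:P * 'X^(j.+1)).
Proof.
elim: j u v => [|j IH] u v; first by rewrite mul1mx mxE expr0 mul1r.
rewrite /= -mulmxA mxE /mulX.
under eq_bigr do rewrite IH !mxE /tX.
rewrite rmorph_sum mulr_suml mulr_sumr; apply: eq_bigr => c _.
rewrite rmorphM /= [(-1) ^+ j.+1]exprS mulN1r !mulNr; congr (- _).
rewrite [LHS]mulrA [_ * 'X * (-1) ^+ j]commr_sign -mulrA; congr (_ * _).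
by rewrite -!mulrA; congr (_ * _); rewrite mulrA -commr_polyX -mulrA -exprS.
Qed.

Lemma coef_blocktrace_tXmx j n :
  (blocktrace (iter j (mulmx (- tXmx)) 1%:M *m tXmx))`_n
  = if n == j.+1 then (-1) ^+ j * supertrace pa (powX x j) else 0.
Proof.
pose f u := (iter j (mulmx (- tXmx)) 1%:M *m tXmx) u u.
have fE u : (f u)`_n = if n == j.+1 then (-1) ^+ j * powX x j u u else 0.
  rewrite /f tXmx_iter -!(signr_odd _ j) !mulr_sign.
  by case: (odd j); rewrite ?coefN coefCM coefXn; case: eqP; rewrite ?mulr1 ?mulr0 ?oppr0.
rewrite /blocktrace /mxtrace coefB !coef_sum.
under eq_bigr => i _ do rewrite mxE mxE -/(f _) fE.
under [X in _ - X]eq_bigr => i _ do rewrite mxE mxE -/(f _) fE.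
rewrite /supertrace big_split_ord; case: eqP => _; last by rewrite !big1 ?subr0.
rewrite /= mulrDr !mulr_sumr -sumrN; congr (_ + _); apply: eq_bigr => i _.
  by rewrite odd_lshift expr0 scale1r.
by rewrite odd_rshift expr1 scaleN1r mulrN.
Qed.

Lemma coef_logderiv n : (n < M)%N ->
  W`_n = if n is r.+1 then (-1) ^+ r * supertrace pa (powX x r) else 0.
Proof.
move=> nM; rewrite (logderiv_blocktrace nM).
have h : eqtmx M (schur_inverse *m tXmx) (\sum_(j < M) (iter j (mulmx (- tXmx)) 1%:M *m tXmx)).
  by rewrite schur_inverse_geometric mulmx_suml.
rewrite (blocktrace_eqt h nM) blocktrace_sum coef_sum.
under eq_bigr => j _ do rewrite coef_blocktrace_tXmx.
case: n nM {h} => [|r] rM; first by rewrite big1.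
have rM' : (r < M)%N by lia.
rewrite (bigD1 (Ordinal rM')) //= eqxx big1 ?addr0 // => j.
by rewrite -(inj_eq val_inj) /= eqSS eq_sym => /negbTE ->.
Qed.

Lemma coef_ber n : (n < M)%N -> (ber_tr x M)`_n = ext_trace pa x n.
Proof.
elim/ltn_ind: n => -[|n] IH nM.
  have i1 : detS_inverse`_0 = 1.
    by have := detS_inv nM; rewrite coef0M (detS_eqt1 (ltn0Sn 0)) coef1 /= mul1r => ->.
  by rewrite ext_trace0 /ber_tr coef0M i1 (detA_eqt1 (ltn0Sn 0)) coef1 mulr1.
have n0 : n.+1%:R != 0 :> k by rewrite ((pcharf0P k).1 char0).
apply: (scalerI n0); rewrite (newton char0 xC) scaler_nat -coef_euler (euler_ber nM).
(* The logarithmic derivative has no constant term; dropping it shifts the index to that of Newton's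
   identity. *)
rewrite coefM big_ord_recl (coef_logderiv (n := 0)) ?mul0r ?add0r; last by lia.
apply: eq_bigr => r _; rewrite lift0 coef_logderiv; last by have := ltn_ord r; lia.
rewrite IH ?subSS; [|by lia..].
by rewrite -mulrA -!(signr_odd _ r) mulr_sign scaler_sign.
Qed.

End Berezinian.

Theorem theorem5p3 (k : fieldType) (N p q : nat) (B : algType k)
    (x : 'I_(p + q) -> 'I_(p + q) -> B)
    (coef : forall l, {ffun 'I_l -> 'I_(p + q)} -> {ffun 'I_l -> 'I_(p + q)} -> k) :
  [pchar k] =i pred0 ->
  (2 <= N)%N ->
  (* the x^a_b are homogeneous of parity \hat a + \hat b and supercommute *)
  (forall a b c e : 'I_(p + q),
     x a b * x c e = (-1) ^+ ((@par p q a + @par p q b) * (@par p q c + @par p q e))%N * (x c e * x a b)) ->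
  @is_expansion k N p q coef ->
  forall n : nat,
    \sum_(l < n.+1) @Fser k N p q B x coef l * @Gser k N p q B x (n - l) = (n == 0)%N%:R.
Proof.
move=> char0 N2 xC0 expc n.
have xC : supercommutes (@odd_letter p q) x x.
  move=> a b c e; rewrite xC0 -signr_odd oddM !oddD /par /parn !oddb.
  by rewrite mulr_sign scaler_sign.
have redP l : reduction (@odd_letter p q) N l (expansion_op N coef l).
  exact: expansion_reduction.
rewrite -(reduced_trace_ext_trace char0 N2 xC redP); apply: eq_bigr => l _.
(* Each e_m is read off from its own truncation modulo t^(m+1), for which the index m is in
   range. *)
rewrite (Fser_reduced_trace N2) /Gser /koszul_sign /ecoef (coef_ber char0 xC) //.
by case: ifP; rewrite ?mul0r.
Qed.
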